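(* For any $\mu\in\Lambda^+$ there is a unique $\mathbb{C}$-algebra epimorphism $\Upsilon_{-\mu}\colon Y_{-\mu}(\mathfrak{gl}_n)\twoheadrightarrow Y^{\mathrm{rtt}}_{-\mu}(\mathfrak{gl}_n)$ defined by $E_i(z)\mapsto e_{i,i+1}(z)$, $F_i(z)\mapsto f_{i+1,i}(z)$, $D_j(z)\mapsto g_j(z)$ ($1\le i<n$, $1\le j\le n$).
   Context: Let $n\ge2$, $\Lambda=\bigoplus_{j=1}^n\mathbb{Z}\epsilon_j$, $\epsilon^\vee_j$ the dual basis, $\alpha^\vee_i=\epsilon^\vee_i-\epsilon^\vee_{i+1}$, $\Lambda^+=\{\nu:\alpha^\vee_i(\nu)\ge0\ \forall 1\le i\le n-1\}$. Drinfeld side: for $\nu\in\Lambda$ with $d_j:=\epsilon^\vee_j(\nu)$, $Y_\nu(\mathfrak{gl}_n)$ is the $\mathbb{C}$-algebra generated by $E_i^{(r)},F_i^{(r)}$ ($1\le i<n$, $r\ge1$), $D_i^{(s)}$ ($s\ge d_i$), $\widetilde D_i^{(s)}$ ($s\ge-d_i$) subject to: (Y0) $D_i^{(d_i)}=1$, $\sum_{t=d_i}^{r+d_i}D_i^{(t)}\widetilde D_i^{(r-t)}=-\delta_{r,0}$, $[D_i^{(r)},D_j^{(s)}]=0$; (Y1) $[E_i^{(r)},F_j^{(s)}]=-\delta_{i,j}\sum_{t=-d_i}^{r+s-1-d_{i+1}}\widetilde D_i^{(t)}D_{i+1}^{(r+s-t-1)}$; (Y2) $[D_i^{(r)},E_j^{(s)}]=(\delta_{i,j+1}-\delta_{i,j})\sum_{t=d_i}^{r-1}D_i^{(t)}E_j^{(r+s-t-1)}$;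 (Y3) $[D_i^{(r)},F_j^{(s)}]=(\delta_{i,j}-\delta_{i,j+1})\sum_{t=d_i}^{r-1}F_j^{(r+s-t-1)}D_i^{(t)}$; (Y4) $[E_i^{(r)},E_i^{(s)}]=\sum_{t=1}^{r-1}E_i^{(t)}E_i^{(r+s-t-1)}-\sum_{t=1}^{s-1}E_i^{(t)}E_i^{(r+s-t-1)}$; (Y5) $[F_i^{(r)},F_i^{(s)}]=\sum_{t=1}^{s-1}F_i^{(r+s-t-1)}F_i^{(t)}-\sum_{t=1}^{r-1}F_i^{(r+s-t-1)}F_i^{(t)}$; (Y6) $[E_i^{(r+1)},E_{i+1}^{(s)}]-[E_i^{(r)},E_{i+1}^{(s+1)}]=-E_i^{(r)}E_{i+1}^{(s)}$; (Y7) $[F_i^{(r+1)},F_{i+1}^{(s)}]-[F_i^{(r)},F_{i+1}^{(s+1)}]=F_{i+1}^{(s)}F_i^{(r)}$; (Y8),(Y9) $[E_i^{(r)},E_j^{(s)}]=0=[F_i^{(r)},F_j^{(s)}]$ if $|i-j|>1$; (Y10),(Y11) for $|i-j|=1$: $[E_i^{(r)},[E_i^{(s)},E_j^{(t)}]]+[E_i^{(s)},[E_i^{(r)},E_j^{(t)}]]=0$, and likewise for $F$. Series: $E_i(z)=\sum_{r\ge1}E_i^{(r)}z^{-r}$, $F_i(z)=\sum_{r\ge1}F_i^{(r)}z^{-r}$, $D_i(z)=\sum_{r\ge d_i}D_i^{(r)}z^{-r}$. RTT side: for $\mu\in\Lambda^+$ put $c_i:=\epsilon^\vee_i(\mu)$.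 $Y^{\mathrm{rtt}}_{-\mu}(\mathfrak{gl}_n)$ is the $\mathbb{C}$-algebra generated by $t_{ij}^{(r)}$ ($1\le i,j\le n$, $r\in\mathbb{Z}$), with $T(z)=\sum_{i,j}t_{ij}(z)\otimes E_{ij}$, $t_{ij}(z)=\sum_{r\in\mathbb{Z}}t_{ij}^{(r)}z^{-r}$, subject to: (1) the RTT relation $R(z-w)T_1(z)T_2(w)=T_2(w)T_1(z)R(z-w)$ with $R(z)=z\cdot\mathrm{Id}+P$, $P=\sum_{i,j}E_{ij}\otimes E_{ji}$; (2) the relations expressing that $T(z)$ admits a Gauss decomposition $T(z)=F(z)G(z)E(z)$ with $F(z)=\sum_iE_{ii}+\sum_{i<j}f_{ji}(z)\otimes E_{ji}$, $G(z)=\sum_ig_i(z)\otimes E_{ii}$, $E(z)=\sum_iE_{ii}+\sum_{i<j}e_{ij}(z)\otimes E_{ij}$, where $e_{ij}(z)=\sum_{r\ge1}e^{(r)}_{ij}z^{-r}$, $f_{ji}(z)=\sum_{r\ge1}f^{(r)}_{ji}z^{-r}$, $g_i(z)=z^{c_i}+\sum_{r\ge1-c_i}g^{(r)}_iz^{-r}$ for some elements $e^{(r)}_{ij},f^{(r)}_{ji},g^{(r)}_i$ of the algebra (these are then uniquely determined by $T(z)$). *)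

(* Defs.v *)
From mathcomp Require Import all_boot all_algebra.
From mathcomp Require Import complex.
From mathcomp Require Import Rstruct.
Set Implicit Arguments.
Unset Strict Implicit.
Unset Printing Implicit Defensive.
Import GRing.Theory.
Local Open Scope ring_scope.

Definition CC : fieldType := complex Rdefinitions.R.

Definition comm (A : algType CC) (x y : A) : A := x * y - y * x.

Definition kdelta (A : algType CC) (i j : nat) : A := (i == j)%:R.

Definition zsum (A : algType CC) (a b : int) (F : int -> A) : A :=
  if (a <= b)%R then \sum_(k < absz (b - a + 1)) F (a + (k : nat)%:Z)
  else 0.

(* Drinfeld side.  A weight nu in Lambda is given by d : nat -> int,
   d j = eps_j^vee(nu) for 1 <= j <= n (other values irrelevant).
   Generators: E i r, F i r (1 <= i < n, r >= 1), D i s (1 <= i <= n,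
   s >= d i), Dt i s (1 <= i <= n, s >= - d i).                        *)
Definition drinfeld_rels (n : nat) (d : nat -> int) (A : algType CC)
  (E F : nat -> int -> A) (D Dt : nat -> int -> A) : Prop :=
  (forall i, (1 <= i <= n)%N -> D i (d i) = 1) /\
  (forall i (r : nat), (1 <= i <= n)%N ->
     zsum (d i) (r%:Z + d i) (fun t => D i t * Dt i (r%:Z - t))
       = - kdelta A r 0) /\
  (forall i j r s, (1 <= i <= n)%N -> (1 <= j <= n)%N ->
     d i <= r -> d j <= s -> comm (D i r) (D j s) = 0) /\
  (forall i j r s, (1 <= i < n)%N -> (1 <= j < n)%N -> 1 <= r -> 1 <= s ->
     comm (E i r) (F j s) =
       - (kdelta A i j *
          zsum (- d i) (r + s - 1 - d i.+1)
               (fun t => Dt i t * D i.+1 (r + s - t - 1)))) /\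
  (forall i j r s, (1 <= i <= n)%N -> (1 <= j < n)%N -> d i <= r -> 1 <= s ->
     comm (D i r) (E j s) =
       (kdelta A i j.+1 - kdelta A i j) *
         zsum (d i) (r - 1) (fun t => D i t * E j (r + s - t - 1))) /\
  (forall i j r s, (1 <= i <= n)%N -> (1 <= j < n)%N -> d i <= r -> 1 <= s ->
     comm (D i r) (F j s) =
       (kdelta A i j - kdelta A i j.+1) *
         zsum (d i) (r - 1) (fun t => F j (r + s - t - 1) * D i t)) /\
  (forall i r s, (1 <= i < n)%N -> 1 <= r -> 1 <= s ->
     comm (E i r) (E i s) =
       zsum 1 (r - 1) (fun t => E i t * E i (r + s - t - 1))
       - zsum 1 (s - 1) (fun t => E i t * E i (r + s - t - 1))) /\
  (forall i r s, (1 <= i < n)%N -> 1 <= r -> 1 <= s ->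
     comm (F i r) (F i s) =
       zsum 1 (s - 1) (fun t => F i (r + s - t - 1) * F i t)
       - zsum 1 (r - 1) (fun t => F i (r + s - t - 1) * F i t)) /\
  (forall i r s, (1 <= i)%N -> (i.+1 < n)%N -> 1 <= r -> 1 <= s ->
     comm (E i (r + 1)) (E i.+1 s) - comm (E i r) (E i.+1 (s + 1))
       = - (E i r * E i.+1 s)) /\
  (forall i r s, (1 <= i)%N -> (i.+1 < n)%N -> 1 <= r -> 1 <= s ->
     comm (F i (r + 1)) (F i.+1 s) - comm (F i r) (F i.+1 (s + 1))
       = F i.+1 s * F i r) /\
  (forall i j r s, (1 <= i < n)%N -> (1 <= j < n)%N -> (1 < `|i%:Z - j%:Z|)%N ->
     1 <= r -> 1 <= s ->
     comm (E i r) (E j s) = 0 /\ comm (F i r) (F j s) = 0) /\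
  (forall i j r s t, (1 <= i < n)%N -> (1 <= j < n)%N ->
     `|i%:Z - j%:Z|%N = 1%N -> 1 <= r -> 1 <= s -> 1 <= t ->
     comm (E i r) (comm (E i s) (E j t)) + comm (E i s) (comm (E i r) (E j t)) = 0
     /\
     comm (F i r) (comm (F i s) (F j t)) + comm (F i s) (comm (F i r) (F j t)) = 0).

(* (Y, E, F, D, Dt) is the algebra Y_nu(gl_n) presented by the above
   generators and relations: it satisfies the relations and is initial
   among C-algebras equipped with such a family. *)
Definition is_drinfeld_shifted_yangian (n : nat) (d : nat -> int)
  (Y : algType CC) (E F D Dt : nat -> int -> Y) : Prop :=
  drinfeld_rels n d E F D Dt /\
  forall (B : algType CC) (E' F' D' Dt' : nat -> int -> B),
    drinfeld_rels n d E' F' D' Dt' ->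
    exists phi : {lrmorphism Y -> B},
      (forall i r, (1 <= i < n)%N -> 1 <= r ->
          phi (E i r) = E' i r /\ phi (F i r) = F' i r) /\
      (forall i s, (1 <= i <= n)%N -> d i <= s -> phi (D i s) = D' i s) /\
      (forall i s, (1 <= i <= n)%N -> - d i <= s -> phi (Dt i s) = Dt' i s) /\
      (forall psi : {lrmorphism Y -> B},
        (forall i r, (1 <= i < n)%N -> 1 <= r ->
            psi (E i r) = E' i r /\ psi (F i r) = F' i r) ->
        (forall i s, (1 <= i <= n)%N -> d i <= s -> psi (D i s) = D' i s) ->
        (forall i s, (1 <= i <= n)%N -> - d i <= s -> psi (Dt i s) = Dt' i s) ->
        forall y, psi y = phi y).

(* RTT side.  mu in Lambda^+ given by c : nat -> int, c i = eps_i^vee(mu).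
   t i j r = t_{ij}^{(r)} (1 <= i, j <= n, r in Z).                    *)

(* Coefficientwise form of R(z-w) T_1(z) T_2(w) = T_2(w) T_1(z) R(z-w)
   with R(z) = z Id + P: comparing the coefficients of E_ij (x) E_kl and
   of z^{-r} w^{-s} gives
   [t_ij^(r+1), t_kl^(s)] - [t_ij^(r), t_kl^(s+1)]
        = t_kj^(s) t_il^(r) - t_kj^(r) t_il^(s).                        *)
Definition rtt_rel (n : nat) (A : algType CC) (t : nat -> nat -> int -> A)
  : Prop :=
  forall i j k l (r s : int),
    (1 <= i <= n)%N -> (1 <= j <= n)%N -> (1 <= k <= n)%N -> (1 <= l <= n)%N ->
    comm (t i j (r + 1)) (t k l s) - comm (t i j r) (t k l (s + 1))
      = t k j s * t i l r - t k j r * t i l s.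

(* Full coefficient sequences of the Gauss factors:
   F(z)_{ik} = delta_ik + f_{ik}(z) (k < i),
   G(z)_{kk} = g_k(z) = z^{c_k} + sum_{r >= 1 - c_k} g_k^(r) z^{-r},
   E(z)_{kj} = delta_kj + e_{kj}(z) (k < j).
   Coefficient of z^{-r}. *)
Definition fser (A : algType CC) (f : nat -> nat -> int -> A) (i k : nat)
  (r : int) : A :=
  if i == k then (if r == 0 then 1 else 0)
  else if (k < i)%N && (1 <= r) then f i k r else 0.

Definition eser (A : algType CC) (e : nat -> nat -> int -> A) (k j : nat)
  (r : int) : A :=
  if k == j then (if r == 0 then 1 else 0)
  else if (k < j)%N && (1 <= r) then e k j r else 0.

Definition gser (A : algType CC) (c : nat -> int) (g : nat -> int -> A)
  (k : nat) (r : int) : A :=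
  if r == - c k then 1 else if - c k < r then g k r else 0.

(* T(z) = F(z) G(z) E(z), coefficientwise: for every r,
   t_ij^(r) = sum_k sum_{a + b + c' = r} F_ik^(a) g_k^(b) E_kj^(c').
   Here a, c' >= 0 and b >= -c_k, so a, c' <= r + c_k: the finite sum over
   0 <= a, c' <= |r + c_k| contains all nonzero terms. *)
Definition gauss_decomp (n : nat) (c : nat -> int) (A : algType CC)
  (t : nat -> nat -> int -> A) (e f : nat -> nat -> int -> A)
  (g : nat -> int -> A) : Prop :=
  forall i j (r : int), (1 <= i <= n)%N -> (1 <= j <= n)%N ->
    t i j r =
      \sum_(1 <= k < (minn i j).+1)
        \sum_(a < (absz (r + c k)).+1) \sum_(b < (absz (r + c k)).+1)
          fser f i k a%:Z * gser c g k (r - a%:Z - b%:Z) * eser e k j b%:Z.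

Definition rtt_rels (n : nat) (c : nat -> int) (A : algType CC)
  (t : nat -> nat -> int -> A) : Prop :=
  rtt_rel n t /\ exists e f g, gauss_decomp n c t e f g.

Definition is_rtt_shifted_yangian (n : nat) (c : nat -> int)
  (Y : algType CC) (t : nat -> nat -> int -> Y) : Prop :=
  rtt_rels n c t /\
  forall (B : algType CC) (t' : nat -> nat -> int -> B),
    rtt_rels n c t' ->
    exists phi : {lrmorphism Y -> B},
      (forall i j r, (1 <= i <= n)%N -> (1 <= j <= n)%N -> phi (t i j r) = t' i j r) /\
      (forall psi : {lrmorphism Y -> B},
        (forall i j r, (1 <= i <= n)%N -> (1 <= j <= n)%N -> psi (t i j r) = t' i j r) ->
        forall y, psi y = phi y).

Definition dominant (n : nat) (c : nat -> int) : Prop :=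
  forall i, (1 <= i < n)%N -> c i.+1 <= c i.

(* Main.v *)
(* Put [h = 1/(z-w)] and let unprimed and primed letters denote series in [z] and in [w].
   Splitting off the first Gauss factor writes the entries of [T] as [g], [g e_j], [f_i g] and
   [f_i g e_j + s_ij].  Since [g] is regular, the RTT relation for [T] yields, by
   noncommutative elimination, closed formulas for all commutators between [e], [f], [g], [s]
   and their primed versions; among them the RTT relation for the Schur complement [s], so
   that the argument can be iterated.  Every Drinfeld relation but the Serre relations is the
   coefficientwise form of one of these formulas.  The Serre relations with last index 1 follow
   from [[a, b] = 0] (resp. its right-handed analogue), where [a], [b] are the series
   [e_{j,j+1}] and [e_{j,j+2}] in the same variable; this holds because a nonzero [[a, b]]
   would contradict the boundedness of a series in both [1/z] and [1/w].  The general Serre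
   relations follow by induction on the last index.  The relations between the [F] come from
   those between the [E], applied to the transposed matrix over the opposite ring.  Dominance
   makes the Gauss factors of the successive Schur complements divisible by the same power of
   [1/z], so that power series suffice.  For surjectivity, the image contains all Gauss
   factors, hence satisfies the defining relations of the RTT algebra, which therefore retracts
   onto it. *)
From HB Require Import structures.
Require Import Defs.
From mathcomp Require Import all_boot all_order all_algebra.
From mathcomp Require Import complex Rstruct.
From mathcomp Require Import boolp zify.
Set Implicit Arguments.
Unset Strict Implicit.
Unset Printing Implicit Defensive.
Import Order.TTheory GRing.Theory Num.Theory.
Local Open Scope ring_scope.


(** * Identities in a ring with one distinguished central element *)

Inductive ncterm : Type :=
| NCcentral | NCvar of nat | NCzero | NCone
| NCadd of ncterm & ncterm | NCopp of ncterm | NCmul of ncterm & ncterm.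

(* [(k, w)] stands for the [k]-th power of the central element times the word [w]. *)
Definition ncmono := (nat * seq nat)%type.

Definition ncmono_mul (p q : seq ncmono) : seq ncmono :=
  [seq ((x.1 + y.1)%N, x.2 ++ y.2) | x <- p, y <- q].

(* The two components collect the monomials with sign + and with sign -. *)
Fixpoint ncnorm (t : ncterm) : seq ncmono * seq ncmono :=
  match t with
  | NCcentral => ([:: (1, [::])]%N, [::])
  | NCvar i => ([:: (0, [:: i])]%N, [::])
  | NCzero => ([::], [::])
  | NCone => ([:: (0, [::])]%N, [::])
  | NCadd a b => let p := ncnorm a in let q := ncnorm b in
                 (p.1 ++ q.1, p.2 ++ q.2)
  | NCopp a => let p := ncnorm a in (p.2, p.1)
  | NCmul a b => let p := ncnorm a in let q := ncnorm b in
                 (ncmono_mul p.1 q.1 ++ ncmono_mul p.2 q.2,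
                  ncmono_mul p.1 q.2 ++ ncmono_mul p.2 q.1)
  end.

(** Both sides are differences of multisets of monomials. Equality in the free ring is therefore
    tested as $p_1+q_2=q_1+p_2$, and no cancellation of monomials has to be performed. *)
Definition nceq (a b : ncterm) : bool :=
  let p := ncnorm a in let q := ncnorm b in perm_eq (p.1 ++ q.2) (q.1 ++ p.2).

Section NCeval.
Variables (R : pzRingType) (h : R) (env : seq R).
Hypothesis hC : forall x, h * x = x * h.

Fixpoint nceval (t : ncterm) : R :=
  match t with
  | NCcentral => h
  | NCvar i => nth 0 env i
  | NCzero => 0
  | NCone => 1
  | NCadd a b => nceval a + nceval b
  | NCopp a => - nceval a
  | NCmul a b => nceval a * nceval b
  end.

Definition ncmono_eval (m : ncmono) : R :=
  h ^+ m.1 * \prod_(i <- m.2) nth 0 env i.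

Definition ncsum (p : seq ncmono) : R := \sum_(m <- p) ncmono_eval m.

Lemma ncsum_cat p q : ncsum (p ++ q) = ncsum p + ncsum q.
Proof. by rewrite /ncsum big_cat. Qed.

Lemma ncsum_mul p q : ncsum (ncmono_mul p q) = ncsum p * ncsum q.
Proof.
rewrite /ncsum /ncmono_mul big_allpairs_dep mulr_suml /=.
apply: eq_bigr => -[k w] _; rewrite mulr_sumr; apply: eq_bigr => -[l z] _.
rewrite /ncmono_eval /= big_cat /= exprD -!mulrA; congr (_ * _).
rewrite !mulrA; congr (_ * _).
by apply/commr_sym/commrX/commr_sym => //; rewrite /GRing.comm hC.
Qed.

Lemma ncnormP t : nceval t = ncsum (ncnorm t).1 - ncsum (ncnorm t).2.
Proof.
elim: t => [|i|||a IHa b IHb|a IHa|a IHa b IHb] /=.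
- by rewrite /ncsum big_seq1 big_nil /ncmono_eval big_nil expr1 mulr1 subr0.
- by rewrite /ncsum big_seq1 big_nil /ncmono_eval big_seq1 expr0 mul1r subr0.
- by rewrite /ncsum big_nil subr0.
- by rewrite /ncsum big_seq1 big_nil /ncmono_eval big_nil expr0 mulr1 subr0.
- by rewrite IHa IHb !ncsum_cat opprD addrACA.
- by rewrite IHa opprB.
- by rewrite IHa IHb !ncsum_cat !ncsum_mul mulrBl !mulrBr opprB opprD addrACA.
Qed.

Lemma nceqP a b : nceq a b -> nceval a = nceval b.
Proof.
move=> ab; apply/eqP; rewrite !ncnormP subr_eq addrAC eq_sym subr_eq eq_sym.
by rewrite -!ncsum_cat /ncsum (perm_big _ ab).
Qed.

End NCeval.

Ltac nc_index x l :=
  lazymatch l with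
  | x :: _ => constr:(0%N)
  | _ :: ?l' => let k := nc_index x l' in constr:(k.+1)
  end.

Ltac nc_insert x l :=
  match l with
  | _ => let _ := nc_index x l in l
  | _ => constr:(x :: l)
  end.

Ltac nc_atoms h t l :=
  lazymatch t with
  | h => l
  | GRing.add ?a ?b => let l := nc_atoms h a l in nc_atoms h b l
  | GRing.mul ?a ?b => let l := nc_atoms h a l in nc_atoms h b l
  | GRing.opp ?a => nc_atoms h a l
  | @GRing.zero _ => l
  | @GRing.one _ => l
  | _ => nc_insert t l
  end.

Ltac nc_reify h t l :=
  lazymatch t with
  | h => constr:(NCcentral)
  | GRing.add ?a ?b =>
      let a := nc_reify h a l in let b := nc_reify h b l in constr:(NCadd a b)
  | GRing.mul ?a ?b =>
      let a := nc_reify h a l in let b := nc_reify h b l in constr:(NCmul a b)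
  | GRing.opp ?a => let a := nc_reify h a l in constr:(NCopp a)
  | @GRing.zero _ => constr:(NCzero)
  | @GRing.one _ => constr:(NCone)
  | _ => let i := nc_index t l in constr:(NCvar i)
  end.

Ltac ncring hC :=
  lazymatch type of hC with
  | forall x, ?h * x = x * ?h =>
    lazymatch goal with
    | |- @eq ?R ?a ?b =>
      let l := nc_atoms h a (@nil R) in
      let l := nc_atoms h b l in
      let ta := nc_reify h a l in
      let tb := nc_reify h b l in
      exact: (@nceqP _ h l hC ta tb isT)
    end
  end.

(* [lincomb H]: closes [a = b] when [a - b] and the difference of the two sides of [H]
   agree in the free ring. *)
Lemma lincombP (V : zmodType) (a b x y : V) : x = y -> a - b = x - y -> a = b.
Proof. by move=> -> ab; apply/subr0_eq; rewrite ab subrr. Qed.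

(** [eqD], [eqB] and [eqM] assemble known equations into the two-sided linear combinations that are
    handed to [lincomb] as certificates. *)
Lemma eqD (V : zmodType) (a b x y : V) : a = b -> x = y -> a + x = b + y.
Proof. by move=> -> ->. Qed.

Lemma eqB (V : zmodType) (a b x y : V) : a = b -> x = y -> a - x = b - y.
Proof. by move=> -> ->. Qed.

Lemma eqM (R : pzRingType) (x y a b : R) : a = b -> x * a * y = x * b * y.
Proof. by move=> ->. Qed.

Arguments eqM {R} x y {a b}.

Ltac lincomb hC H := apply: (lincombP H); ncring hC.

(** * One step of Gaussian elimination *)

(* [t] and [t'] play the roles of [T(z)] and [T(w)], and [h] that of [1/(z-w)].  The second
   form of the relation is the first one with the two variables exchanged. *)
Definition rtt2 (R : pzRingType) (h : R) (I : pred nat) (t t' : nat -> nat -> R) :=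
  forall i j k l, I i -> I j -> I k -> I l ->
    t i j * t' k l - t' k l * t i j = h * (t' k j * t i l - t k j * t' i l) /\
    t i j * t' k l - t' k l * t i j = h * (t i l * t' k j - t' i l * t k j).

(** [s] is the Schur complement $t_{ij}-t_{im}g^{-1}t_{mj}$, written so that [g] need not be
    invertible. Regularity of [g], recorded in [peel], suffices to cancel it. *)
Definition gauss_step (R : pzRingType) (m : nat) (J : pred nat) (t : nat -> nat -> R)
    (g : R) (e f : nat -> R) (s : nat -> nat -> R) :=
  [/\ t m m = g,
      forall j, J j -> t m j = g * e j,
      forall i, J i -> t i m = f i * g
    & forall i j, J i -> J j -> t i j = f i * g * e j + s i j].

Definition addpred (m : nat) (J : pred nat) : pred nat := fun i => (i == m) || J i.

Record peel (R : pzRingType) (h : R) (m : nat) (J : pred nat)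
    (t : nat -> nat -> R) (g : R) (e f : nat -> R) (s : nat -> nat -> R)
    (t' : nat -> nat -> R) (g' : R) (e' f' : nat -> R) (s' : nat -> nat -> R) : Prop :=
  Peel {
    peel_central : forall x, h * x = x * h;
    peel_rtt : rtt2 h (addpred m J) t t';
    peel_step : gauss_step m J t g e f s;
    peel_step' : gauss_step m J t' g' e' f' s';
    peel_regD : GRing.lreg (1 + h);
    peel_regB : GRing.lreg (1 - h);
    peel_lreg : GRing.lreg g;
    peel_rreg : GRing.rreg g;
    peel_lreg' : GRing.lreg g';
    peel_rreg' : GRing.rreg g' }.

(** Exchanging $z$ and $w$ negates $1/(z-w)$ and interchanges the two forms of [rtt2]. The [_swap]
    lemmas below are all obtained in this way. *)
Lemma peel_swap (R : pzRingType) (h : R) m J t g e f s t' g' e' f' s' :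
  peel h m J t g e f s t' g' e' f' s' -> peel (- h) m J t' g' e' f' s' t g e f s.
Proof.
case=> hC H st st' rD rB rl rr rl' rr'; apply: Peel; rewrite ?opprK //.
  by move=> x; rewrite mulNr hC mulrN.
move=> i j k l Ii Ij Ik Il; have [H1 H2] := H k l i j Ik Il Ii Ij.
by split; rewrite -opprB mulNr; [rewrite H2 | rewrite H1].
Qed.

(* In the opposite ring transposition preserves the RTT relation and exchanges the two
   triangular Gauss factors. *)
Lemma peel_op (R : pzRingType) (h : R) m J t g e f s t' g' e' f' s' :
  peel h m J t g e f s t' g' e' f' s' ->
  @peel R^c h m J (fun i j => t j i) g f e (fun i j => s j i)
                  (fun i j => t' j i) g' f' e' (fun i j => s' j i).
Proof.
case=> hC H [st1 st2 st3 st4] [st1' st2' st3' st4'] rD rB rl rr rl' rr'.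
have cD x : (1 + h) * x = x * (1 + h) by ncring hC.
have cB x : (1 - h) * x = x * (1 - h) by ncring hC.
apply: Peel => //.
- by move=> x; rewrite /GRing.mul /= hC.
- move=> i j k l Ii Ij Ik Il; have [H1 H2] := H j i l k Ij Ii Il Ik.
  have flip (a b c d : R) : a - b = h * (c - d) -> b - a = (d - c) * h.
    by move=> E; rewrite -hC -opprB E -mulrN opprB.
  by split; apply: flip.
- split; [by [] | exact: st3 | exact: st2 | move=> i j Ji Jj].
  by rewrite /GRing.mul /= -/GRing.mul mulrA; apply: st4.
- split; [by [] | exact: st3' | exact: st2' | move=> i j Ji Jj].
  by rewrite /GRing.mul /= -/GRing.mul mulrA; apply: st4'.
- by move=> x y /=; rewrite /GRing.mul /= -!cD => /rD.
- by move=> x y /=; rewrite /GRing.mul /= -!cB => /rB.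
Qed.

Lemma mem_addpred m J : addpred m J m.
Proof. by rewrite /addpred eqxx. Qed.

Lemma sub_addpred m (J : pred nat) i : J i -> addpred m J i.
Proof. by rewrite /addpred orbC => ->. Qed.

(** With all four indices equal to [m] the RTT relation reads $(1+h)[g,g']=0$. *)
Lemma peel_gg (R : pzRingType) (h : R) m J t g e f s t' g' e' f' s' :
  peel h m J t g e f s t' g' e' f' s' ->
  g * g' = g' * g.
Proof.
case=> hC H [st1 _ _ _] [st1' _ _ _] rD _ _ _ _ _; apply: rD.
have [E _] := H m m m m (mem_addpred m J) (mem_addpred m J) (mem_addpred m J)
                        (mem_addpred m J).
rewrite st1 st1' in E; lincomb hC E.
Qed.

Lemma peel_eg (R : pzRingType) (h : R) m J t g e f s t' g' e' f' s' j :
  peel h m J t g e f s t' g' e' f' s' ->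
  J j -> e j * g' - g' * e j = h * (g' * (e' j - e j)).
Proof.
move=> H0 Jj; have E1 := peel_gg H0.
case: H0 => hC H [st1 st2 _ _] [st1' st2' _ _] _ _ rl _ _ _; apply: rl.
have [_ E] := H m j m m (mem_addpred m J) (sub_addpred m Jj) (mem_addpred m J)
                        (mem_addpred m J).
rewrite st1 st1' st2 // st2' // in E.
lincomb hC (eqB E (eqM (1 - h) (e j) E1)).
Qed.

Lemma peel_eg_swap (R : pzRingType) (h : R) m J t g e f s t' g' e' f' s' j :
  peel h m J t g e f s t' g' e' f' s' ->
  J j -> e' j * g - g * e' j = - h * (g * (e j - e' j)).
Proof.
by move=> /peel_swap; apply: peel_eg.
Qed.

Lemma peel_fg (R : pzRingType) (h : R) m J t g e f s t' g' e' f' s' i :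
  peel h m J t g e f s t' g' e' f' s' ->
  J i -> f i * g' - g' * f i = h * ((f i - f' i) * g').
Proof.
move=> H0 Ji; have hC := peel_central H0.
have E : g' * f i - f i * g' = (f' i - f i) * g' * h := peel_eg (peel_op H0) Ji.
lincomb hC (eqM (-1) 1 E).
Qed.

Lemma peel_fg_swap (R : pzRingType) (h : R) m J t g e f s t' g' e' f' s' i :
  peel h m J t g e f s t' g' e' f' s' ->
  J i -> f' i * g - g * f' i = - h * ((f' i - f i) * g).
Proof.
by move=> /peel_swap; apply: peel_fg.
Qed.

(** The commutators of [f i], [g] and [e j] with [g'] are known. They account for the whole
    right-hand side of the RTT relation, so that nothing is left for [s i j]. *)
Lemma peel_sg (R : pzRingType) (h : R) m J t g e f s t' g' e' f' s' i j :
  peel h m J t g e f s t' g' e' f' s' ->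
  J i -> J j -> s i j * g' = g' * s i j.
Proof.
move=> H0 Ji Jj; have E1 := peel_gg H0.
have E2 := peel_eg H0 Jj; have F2 := peel_fg H0 Ji.
case: H0 => hC H [st1 st2 st3 st4] [st1' st2' st3' st4'] _ _ _ _ _ _.
have [_ E] := H i j m m (sub_addpred m Ji) (sub_addpred m Jj) (mem_addpred m J)
                        (mem_addpred m J).
rewrite st1' st2 // st2' // st3 // st3' // st4 // in E.
lincomb hC (eqB (eqB (eqB E (eqM (f i * g) 1 E2)) (eqM 1 (g * e j) F2))
                (eqM ((1 - h) * f i) (e j) E1)).
Qed.

Lemma peel_sg_swap (R : pzRingType) (h : R) m J t g e f s t' g' e' f' s' i j :
  peel h m J t g e f s t' g' e' f' s' ->
  J i -> J j -> s' i j * g = g * s' i j.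
Proof.
by move=> /peel_swap; apply: peel_sg.
Qed.

(** The outer factors [g] and [g'] stay in place because the right-hand side has no common factor to
    cancel them against. *)
Lemma peel_ef (R : pzRingType) (h : R) m J t g e f s t' g' e' f' s' i j :
  peel h m J t g e f s t' g' e' f' s' ->
  J i -> J j -> g * (e j * f' i - f' i * e j) * g' = h * (g * s' i j - s i j * g').
Proof.
move=> H0 Ji Jj; have E1 := peel_gg H0; have E2 := peel_eg H0 Jj.
have F2 := peel_fg H0 Ji; have F2' := peel_fg_swap H0 Ji; have E3 := peel_sg H0 Ji Jj.
case: H0 => hC H [st1 st2 st3 st4] [st1' st2' st3' st4'] _ _ _ _ _ _.
have [_ E] := H m j i m (mem_addpred m J) (sub_addpred m Jj) (sub_addpred m Ji)
                        (mem_addpred m J).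
rewrite st1 st1' st2 // st3' // st4 // st4' // in E.
lincomb hC (eqD (eqD (eqD (eqD (eqB E (eqM (g * f' i) 1 E2)) (eqM h 1 E3))
                          (eqM (1 - h) (g' * e j) F2')) (eqM h (g * e j) F2))
                (eqM (- f' i + h * f i + h * h * (f' i - f i)) (e j) E1)).
Qed.

Lemma peel_ef_swap (R : pzRingType) (h : R) m J t g e f s t' g' e' f' s' i j :
  peel h m J t g e f s t' g' e' f' s' ->
  J i -> J j -> g' * (e' j * f i - f i * e' j) * g = - h * (g' * s i j - s' i j * g).
Proof.
by move=> /peel_swap; apply: peel_ef.
Qed.

Lemma peel_ee (R : pzRingType) (h : R) m J t g e f s t' g' e' f' s' j l :
  peel h m J t g e f s t' g' e' f' s' ->
  J j -> J l -> e j * e' l - e' l * e j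
    = h * (e l * (e' j - e j) - (e' j - e j) * e' l + h * ((e' l - e l) * (e' j - e j))).
Proof.
move=> H0 Jj Jl; have E1 := peel_gg H0; have E2j := peel_eg H0 Jj.
have E2l := peel_eg H0 Jl; have E2s := peel_eg_swap H0 Jl.
case: H0 => hC H [st1 st2 _ _] [st1' st2' _ _] _ _ rl _ rl' _; apply: rl'; apply: rl.
have [_ E] := H m j m l (mem_addpred m J) (sub_addpred m Jj) (mem_addpred m J)
                        (sub_addpred m Jl).
rewrite !st2 // !st2' // in E.
lincomb hC (eqB (eqD (eqD (eqB E (eqM g (e' l) E2j)) (eqM ((1 - h) * g') (e j) E2s))
                     (eqM (h * g) (e' j) E2l))
                (eqM (1 - h) ((e' l + h * (e' l - e l)) * e j) E1)).
Qed.

Lemma peel_ee_swap (R : pzRingType) (h : R) m J t g e f s t' g' e' f' s' j l :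
  peel h m J t g e f s t' g' e' f' s' ->
  J j -> J l -> e' j * e l - e l * e' j
    = - h * (e' l * (e j - e' j) - (e j - e' j) * e l - h * ((e l - e' l) * (e j - e' j))).
Proof.
move=> H0 Jj Jl; rewrite (peel_ee (peel_swap H0)) //.
have hC := peel_central H0; ncring hC.
Qed.

Lemma peel_se (R : pzRingType) (h : R) m J t g e f s t' g' e' f' s' i j l :
  peel h m J t g e f s t' g' e' f' s' ->
  J i -> J j -> J l -> s i j * e' l - e' l * s i j = h * (s i l * (e' j - e j)).
Proof.
move=> H0 Ji Jj Jl; have E1 := peel_gg H0; have E2j := peel_eg H0 Jj.
have E2l := peel_eg H0 Jl; have E2s := peel_eg_swap H0 Jl; have F2 := peel_fg H0 Ji.
have E3j := peel_sg H0 Ji Jj; have E3l := peel_sg H0 Ji Jl.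
have E4 := peel_ef_swap H0 Ji Jl; have E5 := peel_ee H0 Jj Jl.
case: H0 => hC H [st1 st2 st3 st4] [st1' st2' st3' st4'] _ _ _ _ rl' _; apply: rl'.
have [_ E] := H i j m l (sub_addpred m Ji) (sub_addpred m Jj) (mem_addpred m J)
                        (sub_addpred m Jl).
rewrite !st2 // !st2' // !st4 // !st4' // in E.
lincomb hC (eqB (eqB (eqD (eqB (eqD (eqB (eqD (eqD (eqB E (eqM 1 (e' l) E3j))
  (eqM h (e' j) E3l)) (eqM 1 (e j) E4)) (eqM (f i * g) (e' l) E2j))
  (eqM (h * f i * g) (e' j) E2l)) (eqM 1 (e' l * g * e j) F2))
  (eqM ((1 - h) * f i * g') (e j) E2s))
  (eqM ((1 - h) * f i) ((e' l + h * (e' l - e l)) * e j) E1))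
  (eqM (f i * g * g') 1 E5)).
Qed.

Lemma peel_se_swap (R : pzRingType) (h : R) m J t g e f s t' g' e' f' s' i j l :
  peel h m J t g e f s t' g' e' f' s' ->
  J i -> J j -> J l -> s' i j * e l - e l * s' i j = - h * (s' i l * (e j - e' j)).
Proof.
by move=> /peel_swap; apply: peel_se.
Qed.

Lemma peel_sf (R : pzRingType) (h : R) m J t g e f s t' g' e' f' s' i j k :
  peel h m J t g e f s t' g' e' f' s' ->
  J i -> J j -> J k -> s i j * f' k - f' k * s i j = h * ((f i - f' i) * s k j).
Proof.
move=> H0 Ji Jj Jk; have hC := peel_central H0.
have E : f' k * s i j - s i j * f' k = (f' i - f i) * s k j * h :=
  peel_se (peel_op H0) Jj Ji Jk.
lincomb hC (eqM (-1) 1 E).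
Qed.

Lemma peel_sf_swap (R : pzRingType) (h : R) m J t g e f s t' g' e' f' s' i j k :
  peel h m J t g e f s t' g' e' f' s' ->
  J i -> J j -> J k -> s' i j * f k - f k * s' i j = - h * ((f' i - f i) * s' k j).
Proof.
by move=> /peel_swap; apply: peel_sf.
Qed.

Lemma peel_ss (R : pzRingType) (h : R) m J t g e f s t' g' e' f' s' i j k l :
  peel h m J t g e f s t' g' e' f' s' ->
  J i -> J j -> J k -> J l ->
  s i j * s' k l - s' k l * s i j = h * (s' k j * s i l - s k j * s' i l).
Proof.
move=> H0 Ji Jj Jk Jl; have E2 := peel_eg H0 Jj; have E2s := peel_eg_swap H0 Jj.
have E3 := peel_sg H0 Ji Jj; have E3s := peel_sg_swap H0 Ji Jj.
have E4 := peel_ef H0 Ji Jj; have E4s := peel_ef_swap H0 Ji Jj.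
have E5 := peel_ee H0 Jj Jl; have E5s := peel_ee_swap H0 Jj Jl.
have E6 := peel_se H0 Ji Jj Jl; have E6' := peel_se H0 Ji Jl Jj.
have E6s := peel_se_swap H0 Ji Jl Jj; have F6 := peel_sf H0 Ji Jj Jk.
have F6' := peel_sf H0 Jk Jj Ji; have F6s := peel_sf_swap H0 Jk Jj Ji.
case: H0 => hC H [st1 st2 st3 st4] [st1' st2' st3' st4'] _ _ _ _ _ _.
have Im := mem_addpred m J; have Ii := sub_addpred m Ji; have Ij := sub_addpred m Jj.
have Ik := sub_addpred m Jk; have Il := sub_addpred m Jl.
have [Hijkl _] := H i j k l Ii Ij Ik Il; have [Himkl _] := H i m k l Ii Im Ik Il.
have [Hmjkl _] := H m j k l Im Ij Ik Il; have [Hmmkl _] := H m m k l Im Im Ik Il.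
have [Himkm _] := H i m k m Ii Im Ik Im; have [Hmmkm _] := H m m k m Im Im Ik Im.
rewrite (st4 _ _ Ji Jj) (st4' _ _ Jk Jl) (st4' _ _ Jk Jj) (st4 _ _ Ji Jl)
        (st4 _ _ Jk Jj) (st4' _ _ Ji Jl) in Hijkl.
rewrite (st4' _ _ Jk Jl) (st4 _ _ Ji Jl) (st4' _ _ Ji Jl) !st3 ?st3' // in Himkl.
rewrite (st4' _ _ Jk Jl) (st4' _ _ Jk Jj) (st4 _ _ Jk Jj) !st2 ?st2' // in Hmjkl.
rewrite st1 (st4' _ _ Jk Jl) st3 // st3' // st2 // st2' // in Hmmkl.
rewrite !st3 // !st3' // in Himkm.
rewrite st1 st1' st3 // st3' // in Hmmkm.
(* The left-hand side of [K] simplifies to [(f' k * g' * f i - f i * f' k * g') * g], the commutator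
   of [f i] with the entry [t' k m] of the pivot column, times [g]. *)
have K := eqB (eqM (f i) 1 Hmmkm) Himkm.
have L1 := eqD (eqM 1 (g * e l) F6s) (eqM (f' k) (e l) E4s).
have L2 := eqD (eqM (f' k * g' * f i - f i * f' k * g') (e l) E2s)
               (eqM ((f' k * g' * f i - f i * f' k * g') * g) 1 E5s).
have L3 := eqM 1 ((e l + h * (e' l - e l)) * (e' j - e j)) K.
have L4 := eqB (eqM (f k * g) 1 E6s) (eqM (f k) (e' l) E4).
have L5 := eqD (eqM (f i * f k * g - f k * g * f' i) (e' l) E2)
               (eqM ((f i * f k * g - f k * g * f' i) * g') 1 E5).
have L6 := eqD (eqM (h * f' k) (e' l) E3) (eqM (h * f k) (e l) E3s).
have L7 := eqD (eqM (f' k * g') 1 E6') (eqM 1 (g' * e' l) F6').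
(* The sum [t i j - t i m * e j - f i * t m j + f i * t m m * e j] equals [s i j], and [M1] starts
   from the same combination of RTT relations. Its last summand together with [M2] removes the part
   [f' k * g' * e' l] of [t' k l]; [L1] to [L7], multiplied by [h], correct the order of the
   remaining products. *)
have M1 := eqD (eqD (eqB (eqB Hijkl (eqM 1 (e j) Himkl)) (eqM (f i) 1 Hmjkl))
                    (eqM (f i) (e j) Hmmkl)) (eqM (-1) (g' * e' l) F6).
have M2 := eqD (eqM (f' k) (e' l) E3) (eqM (f' k * g') 1 E6).
lincomb hC (eqD (eqB M1 M2)
  (eqM h 1 (eqB (eqD (eqD (eqD (eqD (eqD L1 L2) L3) L4) L5) L6) L7))).
Qed.

Definition brk (R : pzRingType) (x y : R) : R := x * y - y * x.

(** For equal indices the right-hand side of [peel_ee] contains [h] times the bracket itself. Moving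
    it to the left produces a factor $1-h$ on both sides. *)
Lemma peel_ee_diag (R : pzRingType) (h : R) m J t g e f s t' g' e' f' s' j :
  peel h m J t g e f s t' g' e' f' s' -> J j ->
  brk (e j) (e' j) = - h * ((e' j - e j) * (e' j - e j)).
Proof.
move=> H0 Jj; have E := peel_ee H0 Jj Jj; rewrite /brk.
have hC := peel_central H0; apply: (peel_regB H0); lincomb hC E.
Qed.

(** * Serre relations in two variables *)

Section Serre.
Variables (R : pzRingType) (h : R).
Hypotheses (hC : forall x, h * x = x * h) (regD : GRing.lreg (1 + h))
  (regB : GRing.lreg (1 - h)).
Variables (a a' b b' c c' : R).
Hypothesis aa : brk a a' = - h * ((a' - a) * (a' - a)).
Hypothesis cc : brk c c' = - h * ((c' - c) * (c' - c)).
Hypothesis ab : brk a b' = h * (b * (a' - a) - (a' - a) * b' + h * ((b' - b) * (a' - a))).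
Hypothesis ab_swap :
  brk a' b = - h * (b' * (a - a') - (a - a') * b - h * ((b - b') * (a - a'))).
Hypothesis ba_swap :
  brk b' a = - h * (a' * (b - b') - (b - b') * a - h * ((a - a') * (b - b'))).
Hypothesis ca : brk c a' = h * ((b' - b) - (a' - a) * c).
Hypothesis ca_swap : brk c' a = - h * ((b - b') - (a - a') * c').
Hypothesis cb : brk c b' = h * (c * ((b' - b) - (a' - a) * c)).
Hypothesis cb_swap : brk c' b = - h * (c' * ((b - b') - (a - a') * c')).

(** Here [a], [b], [c] stand for $e_{j,j+1}$, $e_{j,j+2}$, $e_{j+1,j+2}$ in $z$, primed letters for
    the same series in $w$. Up to the factor [h], the only term besides the double bracket depends
    on $z$ alone; this is the shape that [boundary_zero] exploits. *)
Lemma serre_left : brk a (brk a c') = h * (brk a b - brk a (brk a c')).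
Proof.
move: aa ba_swap ca_swap; rewrite /brk => QA Q1 QC.
have T := eqD (eqB (eqM 1 a QC) (eqM a 1 QC))
              (eqB (eqM h c' QA) (eqM (h * (a' - a)) 1 QC)).
lincomb hC (eqD (eqM h 1 Q1) (eqM (1 + h) 1 T)).
Qed.

(** Polarisation of $[a,b]=0$ to two independent variables, proved after multiplication by the
    regular elements $1+h$ and $1-h$. *)
Lemma serre_left_mixed : brk a b = 0 -> brk a' b' = 0 -> brk a b' + brk a' b = 0.
Proof.
move: ab ab_swap ba_swap; rewrite /brk => Q2 Q2' Q1 p p'.
apply: regD; apply: regB.
have T := eqD (eqM (-1) 1 Q1) Q2'.
lincomb hC (eqD T (eqB (eqM (h - h * h) 1 p) (eqM (h + h * h) 1 p'))).
Qed.

(** The element [b - a * c] takes over the role of [b]: up to sign it is the entry of $E(z)^{-1}$ at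
    the position of [b]. *)
Lemma serre_right :
  brk c (brk c a') = h * (brk c (brk c a') - brk c (b - a * c)).
Proof.
move: ca cb; rewrite /brk => QC QB.
lincomb hC (eqD (eqB (eqM c 1 QC) (eqM 1 c QC)) (eqM h 1 (eqB QB (eqM c 1 QC)))).
Qed.

Lemma serre_right_swap :
  brk c' (brk c' a) = - h * (brk c' (brk c' a) - brk c' (b' - a' * c')).
Proof.
move: ca_swap cb_swap; rewrite /brk => QC QB.
lincomb hC (eqD (eqB (eqM c' 1 QC) (eqM 1 c' QC)) (eqM (- h) 1 (eqB QB (eqM c' 1 QC)))).
Qed.

Lemma serre_right_mixed :
  brk c (b - a * c) = 0 -> brk c' (b' - a' * c') = 0 ->
  brk c (b' - a' * c') + brk c' (b - a * c) = 0.
Proof.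
move=> P0 P0'.
(* Without its inhomogeneous term [serre_right] says that the double bracket is fixed by
   multiplication by [h], and $1-h$ is regular. *)
have W0 : brk c (brk c a') = 0.
  apply: regB; rewrite mulr0 mulrBl mul1r.
  by rewrite [X in X - _]serre_right P0 subr0 subrr.
have W0' : brk c' (brk c' a) = 0.
  apply: regD; rewrite mulr0 mulrDl mul1r.
  by rewrite [X in X + _]serre_right_swap P0' subr0 mulNr addNr.
move: cc ca ca_swap cb cb_swap P0 P0' W0 W0'.
rewrite /brk => QCc QC QCs QB QBs P0 P0' W0 W0'.
have T1 := eqD (eqM (1 + h) 1 (eqB QB (eqM c 1 QC)))
               (eqM (1 - h) 1 (eqB QBs (eqM c' 1 QCs))).
have T2 := eqD (eqB (eqM c 1 QC) (eqM 1 c' QC)) (eqB (eqM c' 1 QCs) (eqM 1 c QCs)).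
have T3 := eqM h 1 (eqB (eqB W0 P0) (eqB W0' P0')).
lincomb hC (eqD (eqB (eqD T1 T2) (eqM (a' - a) 1 QCc)) T3).
Qed.

End Serre.

(** * Iterated Gaussian elimination *)

Definition range (m n : nat) : pred nat := fun i => (m <= i <= n)%N.

Section Chain.
Variables (S R : pzRingType) (n : nat) (F E : nat -> nat -> S) (G : nat -> S).
Hypotheses (F1 : forall k, F k k = 1) (E1 : forall k, E k k = 1).
Hypotheses (F0 : forall i k, (i < k)%N -> F i k = 0)
           (E0 : forall k j, (j < k)%N -> E k j = 0).

(** A tail of the Gauss sum: what remains of $T$ after $m-1$ elimination steps. For [m = 1] these
    are the entries of $T$ itself. *)
Definition schur (m i j : nat) : S := \sum_(m <= k < n.+1) F i k * G k * E k j.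

Lemma schurS m i j : (m <= n)%N -> schur m i j = F i m * G m * E m j + schur m.+1 i j.
Proof. by move=> mn; rewrite /schur big_ltn. Qed.

Lemma schur_l m i j : (i < m)%N -> schur m i j = 0.
Proof.
move=> im; rewrite /schur big_nat big1 // => k /andP[mk _].
by rewrite F0 ?mul0r // (leq_trans im).
Qed.

Lemma schur_r m i j : (j < m)%N -> schur m i j = 0.
Proof.
move=> jm; rewrite /schur big_nat big1 // => k /andP[mk _].
by rewrite E0 ?mulr0 // (leq_trans jm).
Qed.

Lemma schur_step (phi : {rmorphism S -> R}) m : (m <= n)%N ->
  gauss_step m (range m.+1 n) (fun i j => phi (schur m i j)) (phi (G m))
    (fun j => phi (E m j)) (fun i => phi (F i m)) (fun i j => phi (schur m.+1 i j)).
Proof.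
move=> mn; split=> [|j|i|i j].
- by rewrite schurS // F1 E1 mul1r mulr1 schur_l ?addr0.
- by rewrite schurS // F1 mul1r schur_l // addr0 rmorphM.
- by rewrite schurS // E1 mulr1 schur_r // addr0 rmorphM.
- by rewrite schurS // rmorphD !rmorphM.
Qed.

(** * Elements that commute with a Schur complement *)

Section Commute.
Variables (chi : {rmorphism S -> R}) (y : R).
Hypothesis lregG : forall k, range 1 n k -> GRing.lreg (chi (G k)).
Hypothesis rregG : forall k, range 1 n k -> GRing.rreg (chi (G k)).

(** [G m], [G m * E m j] and [F i m * G m] are entries of the Schur complement, and [G m] has a
    regular image. *)
Lemma schur_comm_factors m : (1 <= m <= n)%N ->
  (forall i j, range m n i -> range m n j -> GRing.comm y (chi (schur m i j))) ->
  [/\ GRing.comm y (chi (G m)), forall j, range m n j -> GRing.comm y (chi (E m j))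
    & forall i, range m n i -> GRing.comm y (chi (F i m))].
Proof.
move=> /andP[m1 mn] H; have [s1 s2 s3 _] := schur_step chi mn.
have Im : range m n m by rewrite /range leqnn.
have cG : GRing.comm y (chi (G m)) by rewrite -s1; apply: H.
split=> // i /[dup] Ii; rewrite /range leq_eqVlt => /andP[/predU1P[<- _|mi ni]].
- by rewrite E1 rmorph1; apply: commr1.
- have := H m i Im Ii; rewrite s2 /range ?mi // /GRing.comm mulrA cG -!mulrA.
  by apply: lregG; rewrite /range m1.
- by rewrite F1 rmorph1; apply: commr1.
- have := H i m Ii Im; rewrite s3 /range ?mi // /GRing.comm => yFG.
  by apply: (rregG (k := m)); rewrite ?/range ?m1 //= -!mulrA yFG cG mulrA.
Qed.

(** The next Schur complement differs from the present one by products of Gauss factors, with which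
    [y] commutes by [schur_comm_factors]. *)
Lemma schur_comm m : (0 < m)%N ->
  (forall i j, range m n i -> range m n j -> GRing.comm y (chi (schur m i j))) ->
  forall k i j, (m <= k)%N -> range k n i -> range k n j -> GRing.comm y (chi (schur k i j)).
Proof.
move=> m0 H k; elim: k => [|k IH] i j.
  by rewrite leqn0 => /eqP m00; rewrite m00 in m0.
rewrite leq_eqVlt => /predU1P[<-|mk Ii Ij]; first exact: H.
have km : (m <= k)%N by [].
have W l : range k.+1 n l -> range k n l by rewrite /range => /andP[/ltnW-> ->].
have kn : (1 <= k <= n)%N.
  by rewrite (leq_trans m0) //= (ltnW (leq_trans _ (proj2 (andP Ii)))) //; case/andP: Ii.
have [cG cE cF] := schur_comm_factors kn (fun i j Ri Rj => IH i j km Ri Rj).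
have := IH i j km (W _ Ii) (W _ Ij); rewrite schurS; last by case/andP: kn.
rewrite rmorphD !rmorphM => cT.
have -> : chi (schur k.+1 i j) =
   chi (F i k) * chi (G k) * chi (E k j) + chi (schur k.+1 i j)
   - chi (F i k) * chi (G k) * chi (E k j) by rewrite addrAC subrr add0r.
apply: commrB => //; apply: commrM; last by apply/cE/W.
by apply: commrM => //; apply/cF/W.
Qed.

Lemma schur_comm_all m : (0 < m)%N ->
  (forall i j, range m n i -> range m n j -> GRing.comm y (chi (schur m i j))) ->
  forall k, (m <= k <= n)%N ->
  [/\ GRing.comm y (chi (G k)), forall j, range k n j -> GRing.comm y (chi (E k j))
    & forall i, range k n i -> GRing.comm y (chi (F i k))].
Proof.
move=> m0 H k /andP[mk kn]; apply: schur_comm_factors; first by rewrite (leq_trans m0).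
by move=> i j Ii Ij; apply: (schur_comm m0 H mk Ii Ij).
Qed.

End Commute.

Variables (h : R) (phi psi : {rmorphism S -> R}).
Hypotheses (hC : forall x, h * x = x * h) (regD : GRing.lreg (1 + h))
  (regB : GRing.lreg (1 - h)).
Hypothesis lregG : forall k, range 1 n k -> GRing.lreg (phi (G k)).
Hypothesis rregG : forall k, range 1 n k -> GRing.rreg (phi (G k)).
Hypothesis lregG' : forall k, range 1 n k -> GRing.lreg (psi (G k)).
Hypothesis rregG' : forall k, range 1 n k -> GRing.rreg (psi (G k)).
Hypothesis rtt : rtt2 h (range 1 n) (fun i j => phi (schur 1 i j))
                                    (fun i j => psi (schur 1 i j)).

Lemma addpred_range m i : (m <= n)%N -> addpred m (range m.+1 n) i = range m n i.
Proof.
by rewrite /addpred /range => mn; case: ltngtP => //= im; rewrite -im mn.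
Qed.

(** Induction along the elimination: [peel_ss] carries the RTT relation from one Schur complement to
    the next. *)
Lemma schur_peel m : (1 <= m <= n)%N ->
  peel h m (range m.+1 n)
    (fun i j => phi (schur m i j)) (phi (G m)) (fun j => phi (E m j))
    (fun i => phi (F i m)) (fun i j => phi (schur m.+1 i j))
    (fun i j => psi (schur m i j)) (psi (G m)) (fun j => psi (E m j))
    (fun i => psi (F i m)) (fun i j => psi (schur m.+1 i j)).
Proof.
move=> /andP[m1 mn].
suff H : rtt2 h (range m n) (fun i j => phi (schur m i j)) (fun i j => psi (schur m i j)).
  apply: Peel => //; try exact: schur_step; try by [apply: lregG; rewrite /range m1
   | apply: rregG; rewrite /range m1 | apply: lregG'; rewrite /range m1
   | apply: rregG'; rewrite /range m1].
  by move=> i j k l; rewrite !addpred_range //; apply: H.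
elim: m m1 mn => // m IH _ mn.
case: m IH mn => [|m] IH mn; first exact: rtt.
have H := IH isT (ltnW mn).
have R1 : range 1 n m.+1 by rewrite /range /= ltnW.
have P : peel h m.+1 (range m.+2 n)
    (fun i j => phi (schur m.+1 i j)) (phi (G m.+1)) (fun j => phi (E m.+1 j))
    (fun i => phi (F i m.+1)) (fun i j => phi (schur m.+2 i j))
    (fun i j => psi (schur m.+1 i j)) (psi (G m.+1)) (fun j => psi (E m.+1 j))
    (fun i => psi (F i m.+1)) (fun i j => psi (schur m.+2 i j)).
  apply: Peel; rewrite ?opprK; auto; try by apply: schur_step; apply: ltnW.
  by move=> i j k l; rewrite !addpred_range ?(ltnW mn) //; apply: H.
move=> i j k l Ii Ij Ik Il; split; first exact: (peel_ss P).
(* The second form of the relation is the first one with the two variables exchanged. *)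
have := peel_ss (peel_swap P) Ik Il Ii Ij; rewrite mulNr => /(congr1 -%R).
by rewrite opprB opprK => ->.
Qed.

End Chain.

Record chain (S R : pzRingType) (n : nat) (F E : nat -> nat -> S) (G : nat -> S)
    (h : R) (phi psi : {rmorphism S -> R}) : Prop := Chain {
  chain_F1 : forall k, F k k = 1;
  chain_E1 : forall k, E k k = 1;
  chain_F0 : forall i k, (i < k)%N -> F i k = 0;
  chain_E0 : forall k j, (j < k)%N -> E k j = 0;
  chain_central : forall x, h * x = x * h;
  chain_regD : GRing.lreg (1 + h);
  chain_regB : GRing.lreg (1 - h);
  chain_lreg : forall k, range 1 n k -> GRing.lreg (phi (G k));
  chain_rreg : forall k, range 1 n k -> GRing.rreg (phi (G k));
  chain_lreg' : forall k, range 1 n k -> GRing.lreg (psi (G k));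
  chain_rreg' : forall k, range 1 n k -> GRing.rreg (psi (G k));
  chain_rtt : rtt2 h (range 1 n) (fun i j => phi (schur n F E G 1 i j))
                                 (fun i j => psi (schur n F E G 1 i j)) }.

Lemma chain_swap (S R : pzRingType) n (F E : nat -> nat -> S) G (h : R) phi psi :
  chain n F E G h phi psi -> chain n F E G (- h) psi phi.
Proof.
case=> F1 E1 F0 E0 hC rD rB l r l' r' H; apply: Chain; rewrite ?opprK //.
  by move=> x; rewrite mulNr hC mulrN.
move=> i j k l0 Ii Ij Ik Il; have [H1 H2] := H k l0 i j Ik Il Ii Ij.
by split; rewrite -opprB mulNr; [rewrite H2 | rewrite H1].
Qed.

(** * Commutation relations between Gauss factors of different elimination steps *)

Section ChainTheory.
Variables (S R : pzRingType) (n : nat) (F E : nat -> nat -> S) (G : nat -> S) (h : R)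
  (phi psi : {rmorphism S -> R}).
Hypothesis H : chain n F E G h phi psi.

Let hC := chain_central H.
Local Notation T := (schur n F E G).

Lemma chain_peel m : (1 <= m <= n)%N ->
  peel h m (range m.+1 n)
    (fun i j => phi (T m i j)) (phi (G m)) (fun j => phi (E m j))
    (fun i => phi (F i m)) (fun i j => phi (T m.+1 i j))
    (fun i j => psi (T m i j)) (psi (G m)) (fun j => psi (E m j))
    (fun i => psi (F i m)) (fun i j => psi (T m.+1 i j)).
Proof. by case: H => *; apply: schur_peel. Qed.

Lemma chain_step (chi : {rmorphism S -> R}) m : (m <= n)%N ->
  gauss_step m (range m.+1 n) (fun i j => chi (T m i j)) (chi (G m))
    (fun j => chi (E m j)) (fun i => chi (F i m)) (fun i j => chi (T m.+1 i j)).
Proof. by case: H => *; apply: schur_step. Qed.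

Lemma chain_comm y k m : (0 < m)%N -> (m <= k <= n)%N ->
  (forall i j, range m n i -> range m n j -> GRing.comm y (phi (T m i j))) ->
  [/\ GRing.comm y (phi (G k)), forall j, range k n j -> GRing.comm y (phi (E k j))
    & forall i, range k n i -> GRing.comm y (phi (F i k))].
Proof.
by move=> m0 km C; case: H => *; apply: (@schur_comm_all S R n F E G _ _ _ _ phi y _ _ m).
Qed.

Lemma chain_GG i : (1 <= i <= n)%N -> GRing.comm (phi (G i)) (psi (G i)).
Proof. by move=> /chain_peel /peel_gg. Qed.

(** By [peel_sg] the diagonal factor commutes with the whole Schur complement that follows it, hence
    with all later Gauss factors. *)
Lemma chain_G_lt i k : (1 <= i)%N -> (i < k <= n)%N ->
  [/\ GRing.comm (psi (G i)) (phi (G k)),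
      forall j, range k n j -> GRing.comm (psi (G i)) (phi (E k j))
    & forall j, range k n j -> GRing.comm (psi (G i)) (phi (F j k))].
Proof.
move=> i1 /andP[ik kn]; have iin : (1 <= i <= n)%N by rewrite i1 (leq_trans (ltnW ik)).
apply: (@chain_comm _ _ i.+1); rewrite // ?ik // => a b Ra Rb.
by apply/esym/(peel_sg (chain_peel iin)).
Qed.

Lemma chain_GE_eq i j : (1 <= i <= n)%N -> range i.+1 n j ->
  brk (psi (G i)) (phi (E i j)) = h * (psi (G i) * (phi (E i j) - psi (E i j))).
Proof.
move=> /chain_peel P Rj; have X := peel_eg P Rj; rewrite /brk.
lincomb hC (eqM (-1) 1 X).
Qed.

Lemma chain_EE i j : (1 <= i <= n)%N -> range i.+1 n j ->
  brk (phi (E i j)) (psi (E i j)) =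
  - h * ((psi (E i j) - phi (E i j)) * (psi (E i j) - phi (E i j))).
Proof. by move=> /chain_peel P Rj; apply: (peel_ee_diag P). Qed.

Lemma chain_EF i : (1 <= i < n)%N ->
  phi (G i) * brk (phi (E i i.+1)) (psi (F i.+1 i)) * psi (G i) =
  h * (phi (G i) * psi (G i.+1) - phi (G i.+1) * psi (G i)).
Proof.
move=> /andP[i1 ni]; have iin : (1 <= i <= n)%N by rewrite i1 ltnW.
have Rj : range i.+1 n i.+1 by rewrite /range leqnn.
have := peel_ef (chain_peel iin) Rj Rj; rewrite /brk => ->.
by have [-> _ _ _] := chain_step phi ni;
   have [-> _ _ _] := chain_step psi ni.
Qed.

(** * Gauss factors of two consecutive elimination steps *)

Section Adjacent.
Variable j : nat.
Hypothesis j_range : (1 <= j < n)%N.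

Let jn : (1 <= j <= n)%N. Proof. by case/andP: j_range => -> /ltnW. Qed.
Let ln : (j.+1 <= n)%N. Proof. by case/andP: j_range. Qed.
Let Rl : range j.+1 n j.+1. Proof. by rewrite /range leqnn. Qed.
Let st := chain_step phi ln.
Let Rw b : range j.+2 n b -> range j.+1 n b.
Proof. by rewrite /range => /andP[/ltnW -> ->]. Qed.

(** A case of [peel_se], since [G j.+1] is the corner entry of the Schur complement at step
    [j.+1]. *)
Lemma chain_GE_next :
  brk (phi (G j.+1)) (psi (E j j.+1)) =
  h * (phi (G j.+1) * (psi (E j j.+1) - phi (E j j.+1))).
Proof.
have X := peel_se (chain_peel jn) Rl Rl Rl; rewrite /brk.
by have [<- _ _ _] := st.
Qed.

(** The commutators of [F a j.+1 * G j.+1] and of [G j.+1] with the given element have matching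
    right-hand sides, and [G j.+1] is right regular. *)
Lemma chain_FE_next a : range j.+2 n a -> GRing.comm (phi (F a j.+1)) (psi (E j j.+1)).
Proof.
move=> Ra; have X := peel_se (chain_peel jn) (Rw Ra) Rl Rl.
have Y := chain_GE_next; have [_ _ s3 _] := st.
rewrite s3 // in X.
apply: (chain_rreg H (k := j.+1)); first by rewrite /range /=.
rewrite /brk in Y; lincomb hC (eqB X (eqM (phi (F a j.+1)) 1 Y)).
Qed.

(** The part [F * G * E] of an entry already accounts for the full right-hand side of [peel_se], so
    that the next Schur complement contributes nothing. *)
Lemma chain_E_schur a b : range j.+2 n a -> range j.+2 n b ->
  GRing.comm (psi (E j j.+1)) (phi (T j.+2 a b)).
Proof.
move=> Ra Rb; have X := peel_se (chain_peel jn) (Rw Ra) (Rw Rb) Rl.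
have Y := peel_se (chain_peel jn) Rl (Rw Rb) Rl.
have Z := chain_FE_next Ra; have [s1 s2 s3 s4] := st.
rewrite s4 // s3 // in X; rewrite s2 // s1 in Y; rewrite /GRing.comm in Z *.
have W := eqB (eqB X (eqM (phi (F a j.+1)) 1 Y)) (eqM 1 (phi (G j.+1) * phi (E j.+1 b)) Z).
lincomb hC (eqM (-1) 1 W).
Qed.

Lemma chain_E_far k : (j.+1 < k <= n)%N ->
  [/\ GRing.comm (psi (E j j.+1)) (phi (G k)),
      forall b, range k n b -> GRing.comm (psi (E j j.+1)) (phi (E k b))
    & forall b, range k n b -> GRing.comm (psi (E j j.+1)) (phi (F b k))].
Proof. by move=> kn; apply: (chain_comm (m := j.+2)) => //; apply: chain_E_schur. Qed.

Lemma chain_EE_next b : range j.+2 n b ->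
  brk (phi (E j.+1 b)) (psi (E j j.+1)) =
  h * ((psi (E j b) - phi (E j b)) - (psi (E j j.+1) - phi (E j j.+1)) * phi (E j.+1 b)).
Proof.
move=> Rb; have X := peel_se (chain_peel jn) Rl (Rw Rb) Rl.
have Y := chain_GE_next; have [s1 s2 _ _] := st.
rewrite s2 // s1 in X; apply: (chain_lreg H (k := j.+1)); first by rewrite /range /=.
rewrite /brk in Y *; lincomb hC (eqB X (eqM 1 (phi (E j.+1 b)) Y)).
Qed.

Lemma chain_EE_mixed b : range j.+2 n b ->
  brk (phi (E j.+1 b)) (psi (E j b)) =
  h * (phi (E j.+1 b) *
       ((psi (E j b) - phi (E j b)) - (psi (E j j.+1) - phi (E j j.+1)) * phi (E j.+1 b))).
Proof.
move=> Rb; have X := peel_se (chain_peel jn) Rl (Rw Rb) (Rw Rb).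
have Y := peel_se (chain_peel jn) Rl Rl (Rw Rb); have [s1 s2 _ _] := st.
rewrite s2 // in X; rewrite s1 s2 // in Y.
apply: (chain_lreg H (k := j.+1)); first by rewrite /range /=.
rewrite /brk; lincomb hC (eqB X (eqM 1 (phi (E j.+1 b)) Y)).
Qed.

End Adjacent.
End ChainTheory.

(** * Formal power series over a noncommutative ring *)

Definition series (A : Type) := nat -> A.

HB.instance Definition _ (A : Type) := gen_eqMixin (series A).
HB.instance Definition _ (A : Type) := gen_choiceMixin (series A).

Section Zmod.
Variable A : zmodType.
Implicit Types f g : series A.

Definition ser_add f g : series A := fun n => f n + g n.
Definition ser_opp f : series A := fun n => - f n.

Fact ser_addA : associative ser_add.
Proof. by move=> f g k; apply: funext => n; apply: addrA. Qed.
Fact ser_addC : commutative ser_add.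
Proof. by move=> f g; apply: funext => n; apply: addrC. Qed.
Fact ser_add0 : left_id (fun _ => 0) ser_add.
Proof. by move=> f; apply: funext => n; apply: add0r. Qed.
Fact ser_addN : left_inverse (fun _ => 0) ser_opp ser_add.
Proof. by move=> f; apply: funext => n; apply: addNr. Qed.

HB.instance Definition _ := GRing.isZmodule.Build (series A)
  ser_addA ser_addC ser_add0 ser_addN.

Lemma serD f g n : (f + g) n = f n + g n. Proof. by []. Qed.
Lemma serN f n : (- f) n = - f n. Proof. by []. Qed.
Lemma serB f g n : (f - g) n = f n - g n. Proof. by []. Qed.
Lemma ser0 n : (0 : series A) n = 0. Proof. by []. Qed.
Lemma ser_sum I r (P : pred I) (f : I -> series A) n :
  (\sum_(i <- r | P i) f i) n = \sum_(i <- r | P i) f i n.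
Proof. by elim/big_rec2: _ => // i y z _ <-. Qed.
End Zmod.

Lemma sum_narrow (V : nmodType) m n (F : nat -> V) : (m <= n)%N ->
  \sum_(i < n.+1 | (i <= m)%N) F i = \sum_(i < m.+1) F i.
Proof. by move=> mn; rewrite (big_ord_narrow_leq mn). Qed.

Section Ring.
Variable A : pzRingType.
Implicit Types f g : series A.

Definition ser_mul f g : series A := fun n => \sum_(i < n.+1) f i * g (n - i)%N.
Definition serC (a : A) : series A := fun n => if n == 0%N then a else 0.

Lemma ser_mul_rev f g n : ser_mul f g n = \sum_(i < n.+1) f (n - i)%N * g i.
Proof.
rewrite /ser_mul (reindex_inj rev_ord_inj) /=.
by apply: eq_bigr => i _; rewrite subSS subKn // -ltnS.
Qed.

Fact ser_mulA : associative ser_mul.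
Proof.
move=> f g k; apply: funext => n; rewrite [RHS]ser_mul_rev [LHS]/ser_mul.
pose c (i j : nat) := f i * g (n - i - j)%N * k j.
transitivity (\sum_(i < n.+1) \sum_(j < n.+1 | (i + j <= n)%N) c i j).
  apply: eq_bigr => i _; rewrite -/(ser_mul g k _) ser_mul_rev big_distrr /=.
  rewrite -(sum_narrow (fun j => f i * (g (n - i - j)%N * k j)) (leq_subr i n)).
  apply: eq_big => [j|j _]; last by rewrite /c mulrA.
  by rewrite /= leq_subRL // -ltnS.
rewrite (exchange_big_dep predT) //=; apply: eq_bigr => j _.
rewrite -/(ser_mul f g _) /ser_mul big_distrl /=.
rewrite -(sum_narrow (fun i => f i * g (n - j - i)%N * k j) (leq_subr j n)).
apply: eq_big => [i|i _]; last by rewrite /c -!subnDA (addnC j).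
have jn : (j <= n)%N by rewrite -ltnS.
by rewrite /= leq_subRL // addnC.
Qed.

Fact ser_mul1l : left_id (serC 1) ser_mul.
Proof.
move=> f; apply: funext => n; rewrite /ser_mul big_ord_recl /= mul1r subn0.
by rewrite big1 ?addr0 // => i _; rewrite mul0r.
Qed.

Fact ser_mul1r : right_id (serC 1) ser_mul.
Proof.
move=> f; apply: funext => n; rewrite ser_mul_rev big_ord_recl /= mulr1 subn0.
by rewrite big1 ?addr0 // => i _; rewrite mulr0.
Qed.

Fact ser_mulDl : left_distributive ser_mul +%R.
Proof.
move=> f g k; apply: funext => n; rewrite /ser_mul serD -big_split /=.
by apply: eq_bigr => i _; rewrite mulrDl.
Qed.

Fact ser_mulDr : right_distributive ser_mul +%R.
Proof.
move=> f g k; apply: funext => n; rewrite /ser_mul serD -big_split /=.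
by apply: eq_bigr => i _; rewrite mulrDr.
Qed.

HB.instance Definition _ := GRing.Zmodule_isPzRing.Build (series A)
  ser_mulA ser_mul1l ser_mul1r ser_mulDl ser_mulDr.

Lemma serM f g n : (f * g) n = \sum_(i < n.+1) f i * g (n - i)%N.
Proof. by []. Qed.

Lemma serM_rev f g n : (f * g) n = \sum_(i < n.+1) f (n - i)%N * g i.
Proof. exact: ser_mul_rev. Qed.

Lemma ser1 n : (1 : series A) n = if n == 0%N then 1 else 0.
Proof. by []. Qed.

Lemma serM0 f g : (f * g) 0%N = f 0%N * g 0%N.
Proof. by rewrite serM big_ord1. Qed.

Lemma serC_mull a f n : (serC a * f) n = a * f n.
Proof.
rewrite serM big_ord_recl /= subn0 big1 ?addr0 // => i _.
by rewrite mul0r.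
Qed.

Lemma serC_mulr a f n : (f * serC a) n = f n * a.
Proof.
rewrite serM_rev big_ord_recl /= subn0 big1 ?addr0 // => i _.
by rewrite mulr0.
Qed.

Fact serC_additive : zmod_morphism serC.
Proof. by move=> a b; apply: funext => -[|n]; rewrite serB //= subr0. Qed.

Fact serC_multiplicative : monoid_morphism serC.
Proof.
split=> // a b; apply: funext => n; rewrite serC_mull.
by case: n => //= n; rewrite mulr0.
Qed.

HB.instance Definition _ := GRing.isZmodMorphism.Build A (series A) serC serC_additive.
HB.instance Definition _ :=
  GRing.isMonoidMorphism.Build A (series A) serC serC_multiplicative.

Lemma ser_central f : (forall n a, f n * a = a * f n) -> forall g, f * g = g * f.
Proof.
move=> fC g; apply: funext => n; rewrite serM serM_rev.
by apply: eq_bigr => i _; rewrite fC.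
Qed.

(** If the coefficients of [g] below [n] vanish, then coefficient [m + n] of [f * g] is
    [f m * g n]. *)
Lemma ser_lreg f m : (forall i, (i < m)%N -> f i = 0) -> GRing.lreg (f m) -> GRing.lreg f.
Proof.
move=> f0 fm; apply: mulrI0_lreg => g fg0; apply: funext => n.
elim/ltn_ind: n => n IH; rewrite ser0; apply: fm; rewrite mulr0.
have /(congr1 (fun k : series A => k (m + n)%N)) := fg0; rewrite ser0 serM.
have mn : (m < (m + n).+1)%N by rewrite ltnS leq_addr.
rewrite (bigD1 (Ordinal mn)) //= addKn big1 ?addr0 // => i /negP im.
case: (ltngtP i m) => [/f0->|mi|im']; rewrite ?mul0r //.
  rewrite IH ?ser0 ?mulr0 // ltn_subLR; first by rewrite ltn_add2r.
  by rewrite -ltnS.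
by case: im; apply/eqP/val_inj.
Qed.

Lemma ser_rreg f m : (forall i, (i < m)%N -> f i = 0) -> GRing.rreg (f m) -> GRing.rreg f.
Proof.
move=> f0 fm g1 g2 /eqP; rewrite -subr_eq0 -mulrBl => /eqP gf0.
apply/eqP; rewrite -subr_eq0; apply/eqP; move: (g1 - g2) gf0 => {g1 g2} g gf0.
apply: funext => n.
elim/ltn_ind: n => n IH; rewrite ser0; apply: fm; rewrite mul0r.
have /(congr1 (fun k : series A => k (m + n)%N)) := gf0; rewrite ser0 serM_rev.
have mn : (m < (m + n).+1)%N by rewrite ltnS leq_addr.
rewrite (bigD1 (Ordinal mn)) //= addKn big1 ?addr0 // => i /negP im.
case: (ltngtP i m) => [/f0->|mi|im']; rewrite ?mulr0 //.
  rewrite IH ?ser0 ?mul0r // ltn_subLR; first by rewrite ltn_add2r.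
  by rewrite -ltnS.
by case: im; apply/eqP/val_inj.
Qed.

End Ring.

(** * Inverses of series with constant term 1 *)

Section Inverse.
Variable A : pzRingType.

(** Each coefficient of the left inverse depends on all earlier ones; keeping them in a list makes
    the recursion structural. *)
Fixpoint ser_inv_seq (f : series A) (n : nat) : seq A :=
  if n is n'.+1 then
    let s := ser_inv_seq f n' in
    rcons s (- \sum_(i < n) nth 0 s i * f (n - i)%N)
  else [:: 1].

Definition ser_inv (f : series A) : series A := fun n => nth 0 (ser_inv_seq f n) n.

Lemma size_ser_inv_seq f n : size (ser_inv_seq f n) = n.+1.
Proof. by elim: n => //= n IH; rewrite size_rcons IH. Qed.

Lemma nth_ser_inv_seq f n i : (i <= n)%N -> nth 0 (ser_inv_seq f n) i = ser_inv f i.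
Proof.
elim: n => [|n IH]; first by rewrite leqn0 => /eqP ->.
rewrite leq_eqVlt => /predU1P[->//|lin] /=.
by rewrite nth_rcons size_ser_inv_seq lin IH.
Qed.

Lemma ser_mulVf (f : series A) : f 0%N = 1 -> ser_inv f * f = 1.
Proof.
move=> f0; apply: funext => -[|n]; first by rewrite serM0 f0 mulr1.
rewrite serM big_ord_recr /= subnn f0 mulr1 {2}/ser_inv /=.
rewrite nth_rcons size_ser_inv_seq ltnn eqxx addrC.
rewrite (eq_bigr (fun i : 'I_n.+1 => ser_inv f i * f (n.+1 - i)%N)) ?addNr // => i _.
by rewrite nth_ser_inv_seq // -ltnS.
Qed.

(** The left inverse has constant term 1, so it has a left inverse in its turn, which must be
    [f]. *)
Lemma ser_mulfV (f : series A) : f 0%N = 1 -> f * ser_inv f = 1.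
Proof.
move=> f0; have E := ser_mulVf f0.
have E' : ser_inv (ser_inv f) * ser_inv f = 1 by apply: ser_mulVf.
suff E'' : ser_inv (ser_inv f) = f by rewrite -{1}E''.
by rewrite -[LHS]mulr1 -E mulrA E' mul1r.
Qed.

End Inverse.

Lemma ser_mul_converse (A : pzRingType) (f g : series A) :
  @GRing.mul (series A^c) f g = @GRing.mul (series A) g f.
Proof. by apply: funext => n; rewrite [LHS]serM [RHS]serM_rev. Qed.

(** * Two-variable series *)

(* With [u = 1/z] and [v = 1/w], a series in [u] and [v] is embedded in [A[[x]][[v]]] by
   [u = x v].  The point of this encoding is that [1/(z-w) = u v / (v - u) = x v / (1 - x)]
   exists in that ring; it is [zw_inv] below. *)
Definition ser2 (A : pzRingType) := series (series A).

Section TwoVariables.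
Variable A : pzRingType.
Implicit Types (f g : series A) (X Y : ser2 A).

Definition mono (n : nat) (a : A) : series A := fun r => if r == n then a else 0.
Definition in_z f : ser2 A := fun n => mono n (f n).
Definition in_w f : ser2 A := fun n => serC (f n).

Lemma mono_mull n a f r : (mono n a * f) r = if (n <= r)%N then a * f (r - n)%N else 0.
Proof.
rewrite serM; case: leqP => nr.
  rewrite -ltnS in nr; rewrite (bigD1 (Ordinal nr)) //= /mono eqxx big1 ?addr0 // => i.
  by rewrite -val_eqE /= => /negbTE ->; rewrite mul0r.
apply: big1 => i _; rewrite /mono (ltn_eqF _) ?mul0r //.
by rewrite (leq_ltn_trans _ nr) // -ltnS.
Qed.

Lemma mono_mulr n a f r : (f * mono n a) r = if (n <= r)%N then f (r - n)%N * a else 0.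
Proof.
rewrite serM_rev; case: leqP => nr.
  rewrite -ltnS in nr; rewrite (bigD1 (Ordinal nr)) //= /mono eqxx big1 ?addr0 // => i.
  by rewrite -val_eqE /= => /negbTE ->; rewrite mulr0.
apply: big1 => i _; rewrite /mono (ltn_eqF _) ?mulr0 //.
by rewrite (leq_ltn_trans _ nr) // -ltnS.
Qed.

Fact in_z_additive : zmod_morphism in_z.
Proof.
move=> f g; apply: funext => n; apply: funext => r.
by rewrite !serB /in_z /mono; case: eqP; rewrite ?subr0.
Qed.

Fact in_z_multiplicative : monoid_morphism in_z.
Proof.
split.
  by apply: funext => -[|n]; apply: funext => -[|r] //; rewrite /in_z /mono /=; case: eqP.
move=> f g; apply: funext => n; apply: funext => r.
rewrite serM ser_sum /in_z /mono serM; case: eqP => [->|rn].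
  apply: eq_bigr => i _; rewrite mono_mull -ltnS ltn_ord /mono.
  by rewrite eqxx.
rewrite big1 // => i _; rewrite mono_mull; case: leqP => // ir.
rewrite /mono; case: eqP; rewrite ?mulr0 // => E; case: rn.
by rewrite -(subnK ir) E subnK // -ltnS.
Qed.

HB.instance Definition _ := GRing.isZmodMorphism.Build (series A) (ser2 A) in_z in_z_additive.
HB.instance Definition _ :=
  GRing.isMonoidMorphism.Build (series A) (ser2 A) in_z in_z_multiplicative.

Fact in_w_additive : zmod_morphism in_w.
Proof. by move=> f g; apply: funext => n; rewrite serB /in_w serB rmorphB. Qed.

Fact in_w_multiplicative : monoid_morphism in_w.
Proof.
split; first by apply: funext => -[|n] //=; apply: funext => -[|r].
move=> f g; apply: funext => n; rewrite /in_w serM rmorph_sum serM.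
by apply: eq_bigr => i _; rewrite rmorphM.
Qed.

HB.instance Definition _ := GRing.isZmodMorphism.Build (series A) (ser2 A) in_w in_w_additive.
HB.instance Definition _ :=
  GRing.isMonoidMorphism.Build (series A) (ser2 A) in_w in_w_multiplicative.

(* The coefficient of [w^(-s)], as a series in [u]. *)
Definition coefw (s : nat) X : series A := fun r => X (r + s)%N r.

Lemma coefwD s X Y : coefw s (X + Y) = coefw s X + coefw s Y. Proof. by []. Qed.
Lemma coefwN s X : coefw s (- X) = - coefw s X. Proof. by []. Qed.
Lemma coefwB s X Y : coefw s (X - Y) = coefw s X - coefw s Y. Proof. by []. Qed.

Lemma coefw_zl s f X : coefw s (in_z f * X) = f * coefw s X.
Proof.
apply: funext => r; rewrite /coefw serM ser_sum serM.
rewrite (eq_bigr (fun i : 'I_(r + s).+1 => if (i <= r)%N then f i * coefw s X (r - i)%N else 0)).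
  by rewrite -big_mkcond /= (sum_narrow (fun i => f i * coefw s X (r - i)%N) (leq_addr s r)).
move=> i _; rewrite mono_mull; case: leqP => // ir; congr (_ * X _ _).
by rewrite addnBAC.
Qed.

Lemma coefw_zr s f X : coefw s (X * in_z f) = coefw s X * f.
Proof.
apply: funext => r; rewrite /coefw serM_rev ser_sum serM_rev.
rewrite (eq_bigr (fun i : 'I_(r + s).+1 => if (i <= r)%N then coefw s X (r - i)%N * f i else 0)).
  by rewrite -big_mkcond /= (sum_narrow (fun i => coefw s X (r - i)%N * f i) (leq_addr s r)).
move=> i _; rewrite mono_mulr; case: leqP => // ir; congr (X _ _ * _).
by rewrite addnBAC.
Qed.

Lemma coefw_w s f : coefw s (in_w f) = serC (f s).
Proof. by apply: funext => -[|r]. Qed.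

Lemma coefw_z s f : coefw s (in_z f) = if s == 0%N then f else 0.
Proof.
rewrite -[in_z f]mulr1 coefw_zl -(rmorph1 in_w) coefw_w ser1.
by case: eqP; rewrite ?rmorph1 ?rmorph0 ?mulr1 ?mulr0.
Qed.

(** The series $x/(1-x)$. *)
Definition geo : series A := fun r => if r == 0%N then 0 else 1.
Definition zw_inv : ser2 A := fun n => if n == 1%N then geo else 0.

Lemma geo_mul f r : (geo * f) r = \sum_(k < r) f k.
Proof.
rewrite serM_rev big_ord_recr /= subnn mul0r addr0; apply: eq_bigr => k _.
by rewrite /geo subn_eq0 leqNgt ltn_ord mul1r.
Qed.

Lemma zw_central X : zw_inv * X = X * zw_inv.
Proof.
apply: ser_central => n f; rewrite /zw_inv; case: (n == 1%N); last by rewrite mulr0 mul0r.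
apply: ser_central => r a; rewrite /geo.
by case: (r == 0%N); rewrite ?mulr0 ?mul0r ?mulr1 ?mul1r.
Qed.

Lemma zw_mul0 X : (zw_inv * X) 0%N = 0.
Proof. by rewrite serM0 mul0r. Qed.

Lemma zw_mulS X n : (zw_inv * X) n.+1 = geo * X n.
Proof.
rewrite serM big_ord_recl mul0r add0r big_ord_recl /= subSS subn0 big1 ?addr0 // => i _.
by rewrite mul0r.
Qed.

Lemma coefw_zw0 s X : coefw s (zw_inv * X) 0%N = 0.
Proof. by rewrite /coefw; case: s => [|s]; rewrite ?zw_mul0 // zw_mulS geo_mul big_ord0. Qed.

(** Coefficient form of $(z-w)\cdot\frac{1}{z-w}X=X$. *)
Lemma coefw_zwS s X r :
  coefw s (zw_inv * X) r.+1 = coefw s.+1 (zw_inv * X) r + coefw s X r.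
Proof. by rewrite /coefw addSn addnS !zw_mulS !geo_mul big_ord_recr. Qed.

(** Since $u=xv$, the monomial $x^rv^n$ is $u^rv^{n-r}$. The condition singles out the series
    without negative powers of $v$. *)
Definition bounded X := forall n r, (n < r)%N -> X n r = 0.

Lemma bounded_zw f g : bounded (in_z f * in_w g).
Proof.
move=> n r nr; rewrite serM ser_sum big1 // => i _.
by rewrite serC_mulr /in_z /mono gtn_eqF ?mul0r // (leq_trans (ltn_ord i)).
Qed.

Lemma bounded_wz f g : bounded (in_w g * in_z f).
Proof.
move=> n r nr; rewrite serM_rev ser_sum big1 // => i _.
by rewrite serC_mull /in_z /mono gtn_eqF ?mulr0 // (leq_trans (ltn_ord i)).
Qed.

Lemma boundedB X Y : bounded X -> bounded Y -> bounded (X - Y).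
Proof. by move=> bX bY n r nr; rewrite !serB bX // bY // subr0. Qed.

(** By the recursion the coefficients of [X] are partial sums of those of [Y] of total degree one
    less. *)
Lemma zw_eq X Y : bounded X -> bounded Y ->
  (forall s, coefw s X 0%N = 0) -> coefw 0 X = 0 ->
  (forall r s, coefw s X r.+1 = coefw s.+1 X r + coefw s Y r) -> X = zw_inv * Y.
Proof.
move=> bX bY X0 X00 XY; apply: funext => -[|n]; apply: funext => r.
  rewrite zw_mul0 ser0; case: r => [|r]; last exact: bX.
  by have := X0 0%N; rewrite /coefw.
rewrite zw_mulS geo_mul.
have sumX a : (a <= n.+1)%N -> X n.+1 a = \sum_(k < a) Y n k.
  elim: a => [_|a IH an]; first by rewrite big_ord0; apply: (X0 n.+1).
  rewrite big_ord_recr /= -IH 1?ltnW //; have := XY a (n - a)%N; rewrite /coefw.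
  by rewrite addSn addnS subnKC.
(* For larger [r] the left-hand side vanishes by boundedness. The right-hand side is then the
   complete sum of degree [n], which is a coefficient of [coefw 0 X] and so zero. *)
case: (leqP r n.+1) => [/sumX//|nr]; rewrite bX //.
transitivity (\sum_(k < n.+1) Y n k).
  rewrite -sumX //; have := congr1 (fun f : series A => f n.+1) X00.
  by rewrite /coefw addn0.
rewrite (big_ord_widen r (Y n) (ltnW nr)) big_mkcond /=; apply: eq_bigr => k _.
by case: ltnP => // nk; rewrite bY.
Qed.

Lemma zw_regD : GRing.lreg (1 + zw_inv).
Proof. by apply: (@ser_lreg _ _ 0) => //; rewrite serD ser1 /= addr0; apply: lreg1. Qed.

Lemma zw_regB : GRing.lreg (1 - zw_inv).
Proof. by apply: (@ser_lreg _ _ 0) => //; rewrite serB ser1 /= subr0; apply: lreg1. Qed.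

Definition leading (m : nat) f := (forall i, (i < m)%N -> f i = 0) /\ f m = 1.

Lemma leading_mono m : leading m (mono m 1).
Proof. by split=> [i im|]; rewrite /mono ?eqxx // ltn_eqF. Qed.

Lemma in_w_reg m f : leading m f -> GRing.lreg (in_w f) /\ GRing.rreg (in_w f).
Proof.
move=> [f0 f1]; have i0 i : (i < m)%N -> in_w f i = 0.
  by move=> /f0 fi; rewrite /in_w fi rmorph0.
have i1 : in_w f m = 1 by rewrite /in_w f1 rmorph1.
by split; [apply: (ser_lreg i0) | apply: (ser_rreg i0)]; rewrite i1; [apply: lreg1 | apply: rreg1].
Qed.

Lemma in_z_reg m f : leading m f -> GRing.lreg (in_z f) /\ GRing.rreg (in_z f).
Proof.
move=> [f0 f1]; have i0 i : (i < m)%N -> in_z f i = 0.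
  by move=> /f0 fi; apply: funext => r; rewrite /in_z fi /mono; case: eqP.
have [m0 m1] := leading_mono m.
split; [apply: (ser_lreg i0) | apply: (ser_rreg i0)]; rewrite /in_z f1.
  by apply: (ser_lreg m0); rewrite m1; apply: lreg1.
by apply: (ser_rreg m0); rewrite m1; apply: rreg1.
Qed.

End TwoVariables.

(** * Relations between the coefficients of the Gauss factors *)

(* The series are normalised by a common power of [z]: [G k] starts in degree [m k]. *)
Record gauss_data (A : pzRingType) (n : nat) (m : nat -> nat)
    (F E : nat -> nat -> series A) (G : nat -> series A) : Prop := GaussData {
  gd_F1 : forall k, F k k = 1;
  gd_E1 : forall k, E k k = 1;
  gd_F0 : forall i k, (i < k)%N -> F i k = 0;
  gd_E0 : forall k j, (j < k)%N -> E k j = 0;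
  gd_Fc : forall i k, (k < i)%N -> F i k 0%N = 0;
  gd_Ec : forall k j, (k < j)%N -> E k j 0%N = 0;
  gd_G : forall k, range 1 n k -> leading (m k) (G k);
  gd_rtt0 : forall i j k l s, range 1 n i -> range 1 n j -> range 1 n k -> range 1 n l ->
    brk (schur n F E G 1 i j 0%N) (schur n F E G 1 k l s) = 0;
  gd_rtt : forall i j k l r s, range 1 n i -> range 1 n j -> range 1 n k -> range 1 n l ->
    brk (schur n F E G 1 i j r.+1) (schur n F E G 1 k l s)
    - brk (schur n F E G 1 i j r) (schur n F E G 1 k l s.+1)
    = schur n F E G 1 k j s * schur n F E G 1 i l r
      - schur n F E G 1 k j r * schur n F E G 1 i l s;
  gd_two : forall x : A, x + x = 0 -> x = 0 }.

Lemma brk_op (A : pzRingType) (x y : A) : @brk A^c x y = - brk x y.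
Proof. by rewrite /brk opprB. Qed.

Lemma brkN (A : pzRingType) (x y : A) : brk x y = - brk y x.
Proof. by rewrite /brk opprB. Qed.

Lemma brkNr (A : pzRingType) (x y : A) : brk x (- y) = - brk x y.
Proof. by rewrite /brk mulrN mulNr opprD. Qed.

Lemma sub_eqR (V : zmodType) (x y z : V) : x - y = z -> x = y + z.
Proof. by move=> <-; rewrite addrC subrK. Qed.

Lemma schur_op (A : pzRingType) n (F E : nat -> nat -> series A) (G : nat -> series A) m i j :
  @schur (series A^c) n (fun i j => E j i) (fun i j => F j i) G m i j = schur n F E G m j i.
Proof.
apply: eq_bigr => k _; rewrite !ser_mul_converse.
by rewrite mulrA.
Qed.

Lemma gauss_data_op (A : pzRingType) n m (F E : nat -> nat -> series A) G :
  gauss_data n m F E G ->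
  @gauss_data A^c n m (fun i j => E j i) (fun i j => F j i) G.
Proof.
case=> F1 E1 F0 E0 Fc Ec Gl r0 rS two; apply: GaussData => //; try by move=> *; auto.
- by move=> i j k l s Ii Ij Ik Il; rewrite brk_op !schur_op r0 // oppr0.
- move=> i j k l r s Ii Ij Ik Il; rewrite !brk_op !schur_op -opprD rS //.
  rewrite opprB; congr (_ - _).
Qed.

(** Supplies [ncring] with a central element where no [h] is at hand. *)
Lemma two_central (A : pzRingType) (x : A) : (1 + 1) * x = x * (1 + 1).
Proof. by rewrite mulrDl mulrDr mul1r mulr1. Qed.

(** * Raising the last index of a Serre relation by one *)

Section SerreStep.
Variables (A : pzRingType) (x1 x1p x2 x2p y : A).
Hypothesis two : forall x : A, x + x = 0 -> x = 0.
Hypothesis x12 : brk x1p x2 - brk x1 x2p = x1 * x2 + x2 * x1.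
Hypothesis S0 : brk x1 (brk x2 y) + brk x2 (brk x1 y) = 0.
Hypothesis S1 : brk x1 (brk x2p y) + brk x2p (brk x1 y) = 0.
Hypothesis S2 : brk x1p (brk x2 y) + brk x2 (brk x1p y) = 0.

(** The suffix [p] marks an index raised by one, and [brk x2p y + x2 * y] will be the bracket of
    [x2] with the successor of [y]. The three given Serre relations, corrected by the bracket of [y]
    with [x12], add up to twice the claim. *)
Lemma serre_step_left :
  brk x1 (brk x2p y + x2 * y) + brk x2 (brk x1p y + x1 * y) = 0.
Proof.
apply: two; move: x12 S0 S1 S2; rewrite /brk => Q T0 T1 T2.
have hC := @two_central A.
lincomb hC (eqD (eqD (eqD T1 T2) T0) (eqB (eqM y 1 Q) (eqM 1 y Q))).
Qed.

Lemma serre_step_right :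
  brk x1 (brk x2p y + y * x2) + brk x2 (brk x1p y + y * x1) = 0.
Proof.
apply: two; move: x12 S0 S1 S2; rewrite /brk => Q T0 T1 T2.
have hC := @two_central A.
lincomb hC (eqD (eqB (eqD T1 T2) T0) (eqB (eqM y 1 Q) (eqM 1 y Q))).
Qed.
End SerreStep.

(* Boundedness in both variables forces the inhomogeneous term [p], which depends on one
   variable only, to vanish. *)
Lemma boundary_zero (A : pzRingType) (x : A) (w : nat -> nat -> A) (p : nat -> A) :
  (forall s, w s 0%N = 0) -> (forall r, w 0%N r = 0) ->
  (forall s r, w s r.+1 = w s.+1 r + ((if s == 0%N then p r else 0) + x * w s r)) ->
  forall r, p r = 0.
Proof.
move=> w0 w0' wS r.
have w1 s : w s.+1 r = 0.
  elim: r s => [|r IH] s; first exact: w0.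
  by rewrite wS !IH /= mulr0 !addr0.
by have := wS 0%N r; rewrite w1 !w0' mulr0 addr0 add0r => <-.
Qed.

Definition ser_shift (A : Type) (k : nat) (f : series A) : series A := fun r => f (r + k)%N.

Section Coefficients.
Variables (A : pzRingType) (n : nat) (m : nat -> nat) (F E : nat -> nat -> series A)
  (G : nat -> series A).
Hypothesis H : gauss_data n m F E G.

(** [zw_eq] converts the coefficientwise RTT relation into the one with $1/(z-w)$; the boundary
    conditions come from [gd_rtt0]. *)
Lemma gauss_chain : chain n F E G (zw_inv A) (@in_z A) (@in_w A).
Proof.
case: (H) => F1 E1 F0 E0 Fc Ec Gl r0 rS two.
apply: Chain => //.
- exact: zw_central.
- exact: zw_regD.
- exact: zw_regB.
- by move=> k /Gl /in_z_reg[].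
- by move=> k /Gl /in_z_reg[].
- by move=> k /Gl /in_w_reg[].
- by move=> k /Gl /in_w_reg[].
have r0' i j k l r : range 1 n i -> range 1 n j -> range 1 n k -> range 1 n l ->
    brk (schur n F E G 1 i j r) (schur n F E G 1 k l 0%N) = 0.
  by move=> Ii Ij Ik Il; rewrite /brk -opprB -/(brk _ _) r0 ?oppr0.
move=> i j k l Ii Ij Ik Il; split; apply: zw_eq.
- by apply: boundedB; [apply: bounded_zw | apply: bounded_wz].
- by apply: boundedB; [apply: bounded_wz | apply: bounded_zw].
- by move=> s; rewrite coefwB coefw_zl coefw_zr coefw_w serB serC_mulr serC_mull; apply: r0.
- apply: funext => r; rewrite coefwB coefw_zl coefw_zr coefw_w serB serC_mulr serC_mull.
  exact: r0'.
- move=> r s; rewrite !(coefwB, coefw_zl, coefw_zr, coefw_w, serB, serC_mulr, serC_mull).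
  by apply/sub_eqR/rS.
- by apply: boundedB; [apply: bounded_zw | apply: bounded_wz].
- by apply: boundedB; [apply: bounded_zw | apply: bounded_wz].
- by move=> s; rewrite coefwB coefw_zl coefw_zr coefw_w serB serC_mulr serC_mull; apply: r0.
- apply: funext => r; rewrite coefwB coefw_zl coefw_zr coefw_w serB serC_mulr serC_mull.
  exact: r0'.
- move=> r s; rewrite !(coefwB, coefw_zl, coefw_zr, coefw_w, serB, serC_mulr, serC_mull).
  (* The second form is the RTT relation with both index pairs, and [r] and [s], exchanged. *)
  apply/sub_eqR; rewrite -(rS k l i j s r) // -!/(brk _ _) addrC.
  by rewrite (brkN (schur n F E G 1 i j r.+1)) (brkN (schur n F E G 1 i j r)) opprK.
Qed.

Let C := gauss_chain.
Let Cs := chain_swap C.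

(** * Coefficients of the commutation relations *)

Lemma coefw_comm (X Y : series A) : GRing.comm (in_w X) (in_z Y) -> forall r s, brk (Y r) (X s) = 0.
Proof.
move=> XY r s; have := congr1 (fun Z => coefw s Z r) XY.
rewrite coefw_zr coefw_zl coefw_w serC_mull serC_mulr /brk => ->.
by rewrite subrr.
Qed.

Lemma coefw_brk s (X Y : series A) r : coefw s (brk (in_z X) (in_w Y)) r = brk (X r) (Y s).
Proof. by rewrite coefwB coefw_zl coefw_zr coefw_w serB serC_mull serC_mulr. Qed.

Lemma brk_rec (X Y : series A) Z r s : brk (in_z X) (in_w Y) = zw_inv A * Z ->
  brk (X r.+1) (Y s) - brk (X r) (Y s.+1) = coefw s Z r.
Proof. by move=> XY; rewrite -!coefw_brk XY coefw_zwS addrAC subrr add0r. Qed.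

Lemma brk_recN (X Y : series A) Z r s : brk (in_z X) (in_w Y) = - zw_inv A * Z ->
  brk (X r.+1) (Y s) - brk (X r) (Y s.+1) = - coefw s Z r.
Proof. by rewrite mulNr -mulrN => /brk_rec ->; rewrite coefwN. Qed.

Lemma G_comm i j r s : range 1 n i -> range 1 n j -> brk (G i r) (G j s) = 0.
Proof.
move=> Ii Ij; case: (ltngtP i j) => [ij|ji|<-].
- rewrite brkN; apply/eqP; rewrite oppr_eq0; apply/eqP/coefw_comm.
  by have [] := chain_G_lt C (i := i) (k := j); rewrite ?ij //; case/andP: Ii; case/andP: Ij.
- apply: coefw_comm.
  by have [] := chain_G_lt C (i := j) (k := i); rewrite ?ji //; case/andP: Ii; case/andP: Ij.
- by apply: coefw_comm; apply/esym/(chain_GG C).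
Qed.

Lemma GE_comm i j r s : range 1 n i -> (1 <= j < n)%N -> i != j -> i != j.+1 ->
  brk (G i r) (E j j.+1 s) = 0.
Proof.
move=> /andP[i1 ni] /andP[j1 nj]; case: (ltngtP i j) => // [ij _ _|ji _].
  rewrite brkN; apply/eqP; rewrite oppr_eq0; apply/eqP/coefw_comm.
  have [] := chain_G_lt C (i := i) (k := j); rewrite ?ij //=; first exact: ltnW.
  by move=> _ + _; apply; rewrite /range leqnSn.
rewrite neq_ltn ltnS leqNgt ji /= => ij; apply: coefw_comm.
have jn : (1 <= j < n)%N by rewrite j1.
by have [|//] := chain_E_far C jn (k := i); rewrite ?ij.
Qed.

Lemma GE_eq i r s : (1 <= i < n)%N -> (0 < s)%N ->
  brk (G i r.+1) (E i i.+1 s) - brk (G i r) (E i i.+1 s.+1) = - (G i r * E i i.+1 s).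
Proof.
move=> /andP[i1 ni] s0; have iin : (1 <= i <= n)%N by rewrite i1 ltnW.
have Rj : range i.+1 n i.+1 by rewrite /range leqnn.
rewrite (brk_recN _ _ (chain_GE_eq Cs iin Rj)); congr (- _).
rewrite coefw_zl coefwB coefw_w coefw_z.
by case: s s0 => // s _; rewrite subr0 serC_mulr.
Qed.

Lemma GE_next j r s : (1 <= j < n)%N -> (0 < s)%N ->
  brk (G j.+1 r.+1) (E j j.+1 s) - brk (G j.+1 r) (E j j.+1 s.+1) = G j.+1 r * E j j.+1 s.
Proof.
move=> jn s0; rewrite (brk_rec _ _ (chain_GE_next C jn)) coefw_zl coefwB coefw_w coefw_z.
by case: s s0 => // s _; rewrite subr0 serC_mulr.
Qed.

Lemma EF_comm i j r s : (1 <= i)%N -> (i < j < n)%N ->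
  brk (E i i.+1 r) (F j.+1 j s) = 0.
Proof.
move=> i1 /andP[ij jn]; have iin : (1 <= i < n)%N by rewrite i1 (ltn_trans ij).
rewrite brkN; apply/eqP; rewrite oppr_eq0; apply/eqP/coefw_comm.
have Rj : range j n j.+1 by rewrite /range leqnSn.
case: (ltngtP i.+1 j) => [ij'||ij'].
- by have [|_ _ +] := chain_E_far C iin (k := j); rewrite ?ij' ?(ltnW jn) //; apply.
- by rewrite ltnNge ij.
- subst j; apply/esym/(chain_FE_next C iin).
  by rewrite /range leqnn.
Qed.

Lemma E_far i j r s : (1 <= i)%N -> (i.+1 < j < n)%N ->
  brk (E i i.+1 r) (E j j.+1 s) = 0.
Proof.
move=> i1 /andP[ij jn]; have iin : (1 <= i < n)%N by rewrite i1 (ltn_trans _ jn) // ltnW.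
rewrite brkN; apply/eqP; rewrite oppr_eq0; apply/eqP/coefw_comm.
have Rj : range j n j.+1 by rewrite /range leqnSn.
by have [|_ + _] := chain_E_far C iin (k := j); rewrite ?ij ?(ltnW jn) //; apply.
Qed.

(** The starting point for the recursion [EE_rec], read off directly because the right-hand side has
    no constant term in $1/z$. *)
Lemma EE_first i s : (1 <= i < n)%N ->
  brk (E i i.+1 1%N) (E i i.+1 s) = - (E i i.+1 * E i i.+1) s.
Proof.
move=> /andP[i1 ni]; have iin : (1 <= i <= n)%N by rewrite i1 ltnW.
have Rj : range i.+1 n i.+1 by rewrite /range leqnn.
have X := chain_EE C iin Rj; have Ec := gd_Ec H (ltnSn i).
rewrite -coefw_brk X mulNr coefwN serN coefw_zwS coefw_zw0 add0r; congr (- _).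
rewrite mulrBl !mulrBr -!rmorphM !coefwB coefw_zl coefw_zr !coefw_w coefw_z !serB.
rewrite serC_mull serC_mulr Ec mulr0 mul0r !subr0 sub0r opprK.
by case: eqP; rewrite ?addr0 //= serM0 Ec mulr0 addr0.
Qed.

Lemma EE_rec i r s : (1 <= i < n)%N -> (0 < r)%N -> (0 < s)%N ->
  brk (E i i.+1 r.+1) (E i i.+1 s) - brk (E i i.+1 r) (E i i.+1 s.+1) =
  E i i.+1 r * E i i.+1 s + E i i.+1 s * E i i.+1 r.
Proof.
move=> /andP[i1 ni] r0 s0; have iin : (1 <= i <= n)%N by rewrite i1 ltnW.
have Rj : range i.+1 n i.+1 by rewrite /range leqnn.
rewrite (brk_recN _ _ (chain_EE C iin Rj)).
rewrite mulrBl !mulrBr -!rmorphM !coefwB coefw_zl coefw_zr !coefw_w coefw_z !serB.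
rewrite serC_mull serC_mulr.
case: r r0 => // r _; case: s s0 => // s _.
by rewrite /= sub0r ser0 subr0 -opprD opprK addrC.
Qed.

Lemma EE_next i r s : (1 <= i)%N -> (i.+1 < n)%N -> (0 < r)%N -> (0 < s)%N ->
  brk (E i i.+1 r.+1) (E i.+1 i.+2 s) - brk (E i i.+1 r) (E i.+1 i.+2 s.+1) =
  - (E i i.+1 r * E i.+1 i.+2 s).
Proof.
move=> i1 ni r0 s0; have iin : (1 <= i < n)%N by rewrite i1 ltnW.
have Rb : range i.+2 n i.+2 by rewrite /range leqnn.
have X := chain_EE_next Cs iin Rb.
have {}X : brk (in_z (E i i.+1)) (in_w (E i.+1 i.+2)) = zw_inv A *
   ((in_z (E i i.+2) - in_w (E i i.+2))
    - (in_z (E i i.+1) - in_w (E i i.+1)) * in_w (E i.+1 i.+2)).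
  by rewrite brkN X mulNr opprK.
rewrite (brk_rec _ _ X) mulrBl -rmorphM !coefwB coefw_zl !coefw_w coefw_z !serB serC_mulr.
by case: r r0 => // r _; case: s s0 => // s _; rewrite /= !subr0 sub0r.
Qed.

(** The coefficient of $z^0$ in [chain_EE_next]. Iterated, it produces all coefficients above the
    diagonal from those next to it. *)
Lemma E_generate i b s : (1 <= i)%N -> (i.+1 < b <= n)%N -> (0 < s)%N ->
  E i b s = brk (E i.+1 b 1%N) (E i i.+1 s).
Proof.
move=> i1 /andP[ib bn] s0; have iin : (1 <= i < n)%N by rewrite i1 (leq_trans (ltnW ib)).
have Rb : range i.+2 n b by rewrite /range ib.
have := brk_rec 0 s (chain_EE_next C iin Rb); rewrite {2}/brk (gd_Ec H ib) mul0r mulr0 !subr0 => ->.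
rewrite mulrBl -rmorphM !coefwB coefw_zr !coefw_w !coefw_z !serB serC_mull.
by rewrite (gd_Ec H ib) mulr0 sub0r opprK; case: s s0 => // s _; rewrite /= !ser0 subr0 addr0.
Qed.

Lemma GE_sum_eq i p q : (1 <= i < n)%N ->
  brk (G i (p + m i)%N) (E i i.+1 q.+1) =
  - \sum_(k < p) G i (k + m i)%N * E i i.+1 (p + q - k)%N.
Proof.
move=> iin; have Ii : range 1 n i by case/andP: iin => i1 /ltnW; rewrite /range i1.
elim: p q => [|p IH] q.
  (* The leading coefficient of [G i] is 1, which commutes with everything. *)
  by rewrite big_ord0 oppr0 (gd_G H Ii).2 /brk mul1r mulr1 subrr.
have /sub_eqR := GE_eq (p + m i) iin (ltn0Sn q); rewrite addSn => ->.
rewrite IH big_ord_recr /= opprD addnS addSn; congr (- _ - _).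
by rewrite -addnS addKn.
Qed.

Lemma GE_sum_next j p q : (1 <= j < n)%N ->
  brk (G j.+1 (p + m j.+1)%N) (E j j.+1 q.+1) =
  \sum_(k < p) G j.+1 (k + m j.+1)%N * E j j.+1 (p + q - k)%N.
Proof.
move=> jn; have Ij : range 1 n j.+1 by case/andP: jn.
elim: p q => [|p IH] q.
  by rewrite big_ord0 (gd_G H Ij).2 /brk mul1r mulr1 subrr.
have /sub_eqR := GE_next (p + m j.+1) jn (ltn0Sn q); rewrite addSn => ->.
rewrite IH big_ord_recr /= addnS addSn; congr (_ + _ * _).
by rewrite -addnS addKn.
Qed.

Lemma EE_sum i p q : (1 <= i < n)%N ->
  brk (E i i.+1 p.+1) (E i i.+1 q.+1) =
  \sum_(k < p) E i i.+1 k.+1 * E i i.+1 (p + q - k)%N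
  - \sum_(k < q) E i i.+1 k.+1 * E i i.+1 (p + q - k)%N.
Proof.
move=> iin; elim: p q => [|p IH] q.
  rewrite EE_first // big_ord0 sub0r serM; congr (- _).
  rewrite big_ord_recr big_ord_recl /= subnn (gd_Ec H) // mul0r mulr0 addr0 add0r.
  by apply: eq_bigr => k _; rewrite subSS.
have /sub_eqR -> := EE_rec iin (ltn0Sn p) (ltn0Sn q); rewrite IH.
rewrite (addnS p q) -(addSn p q) !big_ord_recr /= addnK.
have -> : (p.+1 + q - p)%N = q.+1 by rewrite addSnnS addKn.
by rewrite [E i i.+1 p.+1 * _ + _]addrC opprD !addrA subrK addrAC.
Qed.

(** The hypothesis on [m] makes both diagonal series multiples of the same monomial. After division
    by it, [U] has constant term 1 and can be inverted. *)
Lemma EF_sum i p q : (1 <= i < n)%N -> (m i <= m i.+1)%N ->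
  brk (E i i.+1 p.+1) (F i.+1 i q.+1) =
  (ser_inv (ser_shift (m i) (G i)) * ser_shift (m i) (G i.+1)) (p + q).+1.
Proof.
move=> iin mi; set U := ser_shift (m i) (G i); set V := ser_shift (m i) (G i.+1).
have [i1 ni] := andP iin.
have Ii : range 1 n i by rewrite /range i1 ltnW.
have Ii' : range 1 n i.+1 by rewrite /range.
have [G0 G1] := gd_G H Ii; have [G0' _] := gd_G H Ii'.
have UG : mono (m i) 1 * U = G i.
  apply: funext => r; rewrite mono_mull mul1r /U /ser_shift.
  by case: leqP => [/subnK->|/G0->].
have GU : U * mono (m i) 1 = G i.
  apply: funext => r; rewrite mono_mulr mulr1 /U /ser_shift.
  by case: leqP => [/subnK->|/G0->].
have VG : mono (m i) 1 * V = G i.+1.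
  apply: funext => r; rewrite mono_mull mul1r /V /ser_shift; case: leqP => [/subnK->//|ri].
  by rewrite G0' // (leq_trans ri).
have GV : V * mono (m i) 1 = G i.+1.
  apply: funext => r; rewrite mono_mulr mulr1 /V /ser_shift; case: leqP => [/subnK->//|ri].
  by rewrite G0' // (leq_trans ri).
have U1 : U 0%N = 1 by rewrite /U /ser_shift add0n.
have [lz _] := in_z_reg (leading_mono A (m i)); have [_ rw] := in_w_reg (leading_mono A (m i)).
have /= X := chain_EF C iin.
have {}X : in_z U * brk (in_z (E i i.+1)) (in_w (F i.+1 i)) * in_w U =
           zw_inv A * (in_z U * in_w V - in_z V * in_w U).
  have zG : in_z (G i) = in_z (mono (m i) 1) * in_z U by rewrite -rmorphM UG.
  have zG' : in_z (G i.+1) = in_z (mono (m i) 1) * in_z V by rewrite -rmorphM VG.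
  have wG : in_w (G i) = in_w U * in_w (mono (m i) 1) by rewrite -rmorphM GU.
  have wG' : in_w (G i.+1) = in_w V * in_w (mono (m i) 1) by rewrite -rmorphM GV.
  rewrite zG zG' wG wG' in X; have hC := @zw_central A.
  apply: lz; apply: rw; lincomb hC X.
(* Dividing by $U(z)$ on the left and by $U(w)$ on the right separates the variables. *)
have {}X : brk (in_z (E i i.+1)) (in_w (F i.+1 i)) =
           zw_inv A * (in_w (V * ser_inv U) - in_z (ser_inv U * V)).
  have zl : in_z (ser_inv U) * in_z U = 1 by rewrite -rmorphM ser_mulVf // rmorph1.
  have wr : in_w U * in_w (ser_inv U) = 1 by rewrite -rmorphM ser_mulfV // rmorph1.
  have hC := @zw_central A; rewrite !rmorphM /=.
  set e := in_z (E i i.+1) in X *; set f := in_w (F i.+1 i) in X *.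
  set zi := in_z (ser_inv U) in zl *; set wi := in_w (ser_inv U) in wr *.
  have T1 := eqM (zw_inv A) (in_w V * wi) zl; have T2 := eqM (zw_inv A * zi * in_z V) 1 wr.
  have -> : brk e f = zi * (in_z U * brk e f * in_w U) * wi.
    by rewrite !mulrA zl mul1r -mulrA wr mulr1.
  rewrite X; lincomb hC (eqB T1 T2).
have first r : (0 < r)%N -> brk (E i i.+1 r) (F i.+1 i 1%N) = (ser_inv U * V) r.
  move=> r0; have := brk_rec r 0 X.
  rewrite {1}/brk (gd_Fc H) // mul0r mulr0 subrr sub0r => /(congr1 -%R); rewrite opprK => ->.
  rewrite coefwB coefw_w coefw_z serB; case: r r0 => // r _ /=.
  by rewrite sub0r opprK.
(* Each term of the separated right-hand side depends on one variable only, so for positive indices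
   the bracket is a function of their sum. *)
elim: q p => [|q IH] p; first by rewrite first // addn0.
have := brk_rec p.+1 q.+1 X.
rewrite coefwB coefw_w coefw_z serB /= subr0 IH => /subr0_eq <-.
by rewrite addSn addnS.
Qed.

(** * Serre relations for the coefficients of $E$ *)

Section SerreCoefficients.
Variable j : nat.
Hypotheses (j1 : (1 <= j)%N) (jn : (j.+1 < n)%N).
Local Notation a := (E j j.+1).
Local Notation b := (E j j.+2).
Local Notation c := (E j.+1 j.+2).

Let j_range : (1 <= j < n)%N. Proof. by rewrite j1 (ltnW jn). Qed.
Let j_le : (1 <= j <= n)%N. Proof. by rewrite j1 (ltnW (ltnW jn)). Qed.
Let j1_le : (1 <= j.+1 <= n)%N. Proof. by rewrite (ltnW jn). Qed.
Let Ra : range j.+1 n j.+1. Proof. by rewrite /range leqnn (ltnW jn). Qed.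
Let Rb : range j.+1 n j.+2. Proof. by rewrite /range leqnSn. Qed.
Let Rc : range j.+2 n j.+2. Proof. by rewrite /range leqnn. Qed.
Let a0 : a 0%N = 0. Proof. exact: (gd_Ec H). Qed.
Let c0 : c 0%N = 0. Proof. exact: (gd_Ec H). Qed.

Let zw := zw_inv A.
Let aa := chain_EE C j_le Ra.
Let cc := chain_EE C j1_le Rc.
Let ab := peel_ee (chain_peel C j_le) Ra Rb.
Let ab_swap := peel_ee_swap (chain_peel C j_le) Ra Rb.
Let ba_swap := peel_ee_swap (chain_peel C j_le) Rb Ra.
Let ca := chain_EE_next C j_range Rc.
Let ca_swap := chain_EE_next Cs j_range Rc.
Let cb := chain_EE_mixed C j_range Rc.
Let cb_swap := chain_EE_mixed Cs j_range Rc.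

(** The double bracket of [serre_left] has no constant term in $1/z$ or in $1/w$ and satisfies the
    recursion of [boundary_zero] with inhomogeneous term $[a,b]$. *)
Lemma brk_ab : brk a b = 0.
Proof.
have W := serre_left (@zw_central A) aa ba_swap ca_swap.
pose w s r := coefw s (brk (in_z a) (brk (in_z a) (in_w c))) r.
apply: funext => r; rewrite ser0; move: r; apply: (@boundary_zero A (-1) w).
- by move=> s; rewrite /w W coefw_zw0.
- move=> r; rewrite /w /brk mulrBl mulrBr !coefwB !(coefw_zl, coefw_zr) coefw_w c0 rmorph0.
  by rewrite !(mulr0, mul0r) !subr0.
- move=> s r; rewrite /w [in LHS]W coefw_zwS -W; congr (_ + _).
  rewrite coefwB serB mulN1r; congr (_ - _).
  by rewrite /brk -!rmorphM -rmorphB coefw_z; case: (s == 0%N).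
Qed.

Lemma brk_ab_mixed r s : brk (a r) (b s) + brk (a s) (b r) = 0.
Proof.
have p : brk (in_z a) (in_z b) = 0.
  by rewrite /brk -!rmorphM -rmorphB -/(brk a b) brk_ab rmorph0.
have p' : brk (in_w a) (in_w b) = 0.
  by rewrite /brk -!rmorphM -rmorphB -/(brk a b) brk_ab rmorph0.
have := serre_left_mixed (@zw_central A) (@zw_regD A) (@zw_regB A) ab ab_swap ba_swap p p'.
move=> /(congr1 (fun X => coefw s X r)); rewrite coefwD serD coefw_brk.
by rewrite (brkN (in_w a)) coefwN serN coefw_brk -brkN.
Qed.

(** Reduces the Serre relations with last index 1 to [brk_ab_mixed]. *)
Lemma brk_a_c1 r : brk (a r) (c 1%N) = - b r.
Proof.
have X : brk (in_z a) (in_w c) = zw * ((in_z b - in_w b) - (in_z a - in_w a) * in_w c).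
  by rewrite brkN ca_swap mulNr opprK.
have := brk_rec r 0 X; rewrite {1}/brk c0 mulr0 mul0r subrr sub0r => E1.
rewrite -[LHS]opprK E1 mulrBl -rmorphM !coefwB coefw_zl !coefw_w coefw_z.
by rewrite c0 (gd_Ec H (ltnW (ltnSn _))) serM0 c0 mulr0 !rmorph0 mulr0 !subr0.
Qed.

(** Induction on [t]: [EE_next] expresses a bracket with last index [t.+2] through brackets and
    products with last index [t.+1]. *)
Lemma serre_a r s t : (0 < r)%N -> (0 < s)%N -> (0 < t)%N ->
  brk (a r) (brk (a s) (c t)) + brk (a s) (brk (a r) (c t)) = 0.
Proof.
case: t => // t r0 s0 _; elim: t r s r0 s0 => [|t IH] r s r0 s0.
  by rewrite !brk_a_c1 !brkNr -opprD brk_ab_mixed oppr0.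
have rec k : (0 < k)%N -> brk (a k) (c t.+2) = brk (a k.+1) (c t.+1) + a k * c t.+1.
  by move=> k0; have /sub_eqR -> := EE_next (s := t.+1) j1 jn k0 isT; rewrite subrK.
rewrite !rec //; apply: serre_step_left; rewrite ?IH //; first exact: gd_two H.
exact: EE_rec.
Qed.

Local Notation d := (b - a * c).

(** The argument of [brk_ab] applied to [serre_right]; the inhomogeneous term is now the negative of
    $[c,d]$. *)
Lemma brk_cd : brk c d = 0.
Proof.
have W := serre_right (@zw_central A) ca cb.
pose w s r := coefw s (brk (in_z c) (brk (in_z c) (in_w a))) r.
suff Z r : - (brk c d) r = 0 by apply: funext => r; rewrite -[LHS]opprK Z oppr0.
move: r; apply: (@boundary_zero A 1 w (fun r => - (brk c d) r)).
- by move=> s; rewrite /w W coefw_zw0.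
- move=> r; rewrite /w /brk mulrBl mulrBr !coefwB !(coefw_zl, coefw_zr) coefw_w a0 rmorph0.
  by rewrite !(mulr0, mul0r) !subr0.
- move=> s r; rewrite /w [in LHS]W coefw_zwS -W; congr (_ + _).
  rewrite coefwB serB mul1r addrC; congr (_ + _).
  rewrite /brk -!rmorphM -!rmorphB -!rmorphM -rmorphB coefw_z.
  by case: (s == 0%N); rewrite ?oppr0.
Qed.

Lemma brk_cd_mixed r s : brk (c r) (d s) + brk (c s) (d r) = 0.
Proof.
have in_d (chi : {rmorphism series A -> ser2 A}) : chi b - chi a * chi c = chi d.
  by rewrite rmorphB rmorphM.
have P (chi : {rmorphism series A -> ser2 A}) : brk (chi c) (chi b - chi a * chi c) = 0.
  by rewrite in_d /brk -!rmorphM -rmorphB -/(brk c d) brk_cd rmorph0.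
have := serre_right_mixed (@zw_central A) (@zw_regD A) (@zw_regB A) cc ca ca_swap cb cb_swap
  (P _) (P _).
rewrite !in_d => /(congr1 (fun X => coefw s X r)); rewrite coefwD serD coefw_brk.
by rewrite (brkN (in_w c)) coefwN serN coefw_brk -brkN.
Qed.

Lemma brk_c_a1 r : brk (c r) (a 1%N) = d r.
Proof.
have := brk_rec r 0 ca; rewrite {1}/brk a0 mulr0 mul0r subrr sub0r => E1.
rewrite -[LHS]opprK E1 mulrBl -rmorphM !coefwB coefw_zr !coefw_w !coefw_z.
by rewrite a0 (gd_Ec H (ltnW (ltnSn _))) !rmorph0 mul0r !sub0r opprB opprK addrC.
Qed.

Lemma serre_c r s t : (0 < r)%N -> (0 < s)%N -> (0 < t)%N ->
  brk (c r) (brk (c s) (a t)) + brk (c s) (brk (c r) (a t)) = 0.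
Proof.
case: t => // t r0 s0 _; elim: t r s r0 s0 => [|t IH] r s r0 s0.
  by rewrite !brk_c_a1 brk_cd_mixed.
have rec k : (0 < k)%N -> brk (c k) (a t.+2) = brk (c k.+1) (a t.+1) + a t.+1 * c k.
  move=> k0; have := EE_next (r := t.+1) j1 jn isT k0.
  rewrite (brkN (a t.+2)) (brkN (a t.+1)) => /(congr1 -%R); rewrite opprB !opprK.
  by rewrite [X in X = _]addrC => /sub_eqR.
rewrite !rec //; apply: serre_step_right; rewrite ?IH //; first exact: gd_two H.
exact: EE_rec.
Qed.

End SerreCoefficients.

End Coefficients.

(** * Relations involving $F$, by transposition over the opposite ring *)

Section Transposed.
Variables (A : pzRingType) (n : nat) (m : nat -> nat) (F E : nat -> nat -> series A)
  (G : nat -> series A).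
Hypothesis H : gauss_data n m F E G.

Let Hop := gauss_data_op H.

Let opp_brk (x y z : A) : @brk A^c x y = z -> brk x y = - z.
Proof. by rewrite brk_op => <-; rewrite opprK. Qed.

Lemma FE_comm i j r s : (1 <= j)%N -> (j < i < n)%N ->
  brk (E i i.+1 r) (F j.+1 j s) = 0.
Proof. by move=> j1 ij; rewrite brkN -brk_op; apply: (EF_comm Hop). Qed.

Lemma GF_comm i j r s : range 1 n i -> (1 <= j < n)%N -> i != j -> i != j.+1 ->
  brk (G i r) (F j.+1 j s) = 0.
Proof.
move=> Ii Ij ij ij'; rewrite -[0]oppr0; apply: opp_brk.
exact: (GE_comm Hop r s Ii Ij ij ij').
Qed.

Lemma GF_sum_eq i p q : (1 <= i < n)%N ->
  brk (G i (p + m i)%N) (F i.+1 i q.+1) =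
  \sum_(k < p) F i.+1 i (p + q - k)%N * G i (k + m i)%N.
Proof. by move=> iin; rewrite (opp_brk (GE_sum_eq Hop p q iin)) opprK. Qed.

Lemma GF_sum_next j p q : (1 <= j < n)%N ->
  brk (G j.+1 (p + m j.+1)%N) (F j.+1 j q.+1) =
  - \sum_(k < p) F j.+1 j (p + q - k)%N * G j.+1 (k + m j.+1)%N.
Proof. by move=> jn; rewrite (opp_brk (GE_sum_next Hop p q jn)). Qed.

Lemma FF_sum i p q : (1 <= i < n)%N ->
  brk (F i.+1 i p.+1) (F i.+1 i q.+1) =
  \sum_(k < q) F i.+1 i (p + q - k)%N * F i.+1 i k.+1
  - \sum_(k < p) F i.+1 i (p + q - k)%N * F i.+1 i k.+1.
Proof. by move=> iin; rewrite (opp_brk (EE_sum Hop p q iin)) opprB. Qed.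

Lemma FF_next i r s : (1 <= i)%N -> (i.+1 < n)%N -> (0 < r)%N -> (0 < s)%N ->
  brk (F i.+1 i r.+1) (F i.+2 i.+1 s) - brk (F i.+1 i r) (F i.+2 i.+1 s.+1) =
  F i.+2 i.+1 s * F i.+1 i r.
Proof.
move=> i1 ni r0 s0; have := EE_next Hop i1 ni r0 s0; rewrite !brk_op => /(congr1 -%R).
by rewrite opprB !opprK addrC => X; exact: X.
Qed.

Lemma F_far i j r s : (1 <= i)%N -> (i.+1 < j < n)%N ->
  brk (F i.+1 i r) (F j.+1 j s) = 0.
Proof. by move=> i1 ij; rewrite -[0]oppr0; apply/opp_brk/(E_far Hop). Qed.

Lemma F_generate i b s : (1 <= i)%N -> (i.+1 < b <= n)%N -> (0 < s)%N ->
  F b i s = brk (F i.+1 i s) (F b i.+1 1%N).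
Proof. by move=> i1 ib s0; have := E_generate Hop i1 ib s0; rewrite brk_op -brkN. Qed.

Let brk_op2 (x y z : A) : @brk A^c x (@brk A^c y z) = brk x (brk y z).
Proof. by rewrite !brk_op brkNr opprK. Qed.

Lemma serre_f_left j r s k : (1 <= j)%N -> (j.+1 < n)%N ->
  (0 < r)%N -> (0 < s)%N -> (0 < k)%N ->
  brk (F j.+1 j r) (brk (F j.+1 j s) (F j.+2 j.+1 k))
  + brk (F j.+1 j s) (brk (F j.+1 j r) (F j.+2 j.+1 k)) = 0.
Proof.
by move=> j1 jn r0 s0 k0; rewrite -!brk_op2; apply: (serre_a Hop).
Qed.

Lemma serre_f_right j r s k : (1 <= j)%N -> (j.+1 < n)%N ->
  (0 < r)%N -> (0 < s)%N -> (0 < k)%N ->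
  brk (F j.+2 j.+1 r) (brk (F j.+2 j.+1 s) (F j.+1 j k))
  + brk (F j.+2 j.+1 s) (brk (F j.+2 j.+1 r) (F j.+1 j k)) = 0.
Proof.
by move=> j1 jn r0 s0 k0; rewrite -!brk_op2; apply: (serre_c Hop).
Qed.

End Transposed.

(** * The presentations in terms of power series *)

Lemma sum_extend (V : zmodType) (p q : nat) (F : nat -> V) :
  (p <= q)%N -> (forall k, (p <= k < q)%N -> F k = 0) ->
  \sum_(k < q) F k = \sum_(k < p) F k.
Proof.
move=> pq F0; rewrite (big_ord_widen q F pq) [RHS]big_mkcond /=.
by apply: eq_bigr => k _; case: ltnP => // pk; rewrite F0 ?pk /=.
Qed.

Lemma zsumE (A : algType CC) (a : int) (p : nat) (F : int -> A) :
  zsum a (a + p%:Z - 1) F = \sum_(k < p) F (a + k%:Z).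
Proof.
rewrite /zsum; case: p => [|p]; first by rewrite big_ord0; case: ifP => //; lia.
have -> : (a <= a + p.+1%:Z - 1)%R by lia.
by have -> : absz (a + p.+1%:Z - 1 - a + 1) = p.+1 by lia.
Qed.

Lemma algC_two (A : algType CC) (x : A) : x + x = 0 -> x = 0.
Proof.
move=> x2; have x2' : (2%:R : CC) *: x = 0 by rewrite scaler_nat mulr2n.
have two0 : (2%:R : CC) != 0.
  by have := pnatr_eq0 (complex Rdefinitions.R) 2 => /= /negbT.
by rewrite -[x](scalerK two0) x2' scaler0.
Qed.

Section Translation.
Variables (n : nat) (c : nat -> int) (A : algType CC) (t : nat -> nat -> int -> A)
  (e f : nat -> nat -> int -> A) (g : nat -> int -> A).
Hypotheses (n_gt0 : (0 < n)%N) (c_dom : dominant n c) (t_rtt : rtt_rel n t)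
  (t_gauss : gauss_decomp n c t e f g).

(** All of $T(z)$ is multiplied by $z^{-c_1}$. By dominance $c_1$ is the largest weight, so
    $z^{-c_1}g_k(z)$ is a power series in $1/z$ of order $c_1-c_k$. *)
Definition shift_of (k : nat) : nat := absz (c 1%N - c k).
Definition serE (k j : nat) : series A := fun r => eser e k j r%:Z.
Definition serF (i k : nat) : series A := fun r => fser f i k r%:Z.
Definition serG (k : nat) : series A := fun r => gser c g k (r%:Z - c 1%N).

Lemma c_le1 k : range 1 n k -> c k <= c 1%N.
Proof.
case: k => // k; elim: k => // k IH /andP[_ kn].
by apply: le_trans (c_dom _) (IH _); rewrite /range /= ?kn // ltnW.
Qed.

Lemma c_shift k : range 1 n k -> c k = c 1%N - (shift_of k)%:Z.
Proof. by move=> /c_le1; rewrite /shift_of; lia. Qed.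

Lemma shift_le k : (1 <= k < n)%N -> (shift_of k <= shift_of k.+1)%N.
Proof.
move=> kn; have := c_dom kn; have [k1 kn'] := andP kn.
have /c_le1 : range 1 n k by rewrite /range k1 ltnW.
have /c_le1 : range 1 n k.+1 by [].
by rewrite /shift_of; lia.
Qed.

Lemma serG_leading k : range 1 n k -> leading (shift_of k) (serG k).
Proof.
move=> /c_shift ck; split=> [i ik|]; rewrite /serG /gser ck.
  by rewrite [_ == _]negbTE; [rewrite [_ < _]negbTE //|]; lia.
by rewrite [_ == _](_ : _ = true) //; apply/eqP; lia.
Qed.

Lemma gserE k (p : nat) : range 1 n k -> gser c g k (- c k + p%:Z) = serG k (p + shift_of k).
Proof. by move=> /c_shift ck; rewrite /serG; congr gser; rewrite ck; lia. Qed.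

Lemma gser_low k (r : int) : r < - c k -> gser c g k r = 0.
Proof. by move=> rk; rewrite /gser !ifF //; apply/negbTE; lia. Qed.

Lemma t_low i j (r : int) : range 1 n i -> range 1 n j -> r < - c 1%N -> t i j r = 0.
Proof.
move=> Ii Ij r1; rewrite t_gauss // big_nat big1 // => k /andP[k1 ki].
rewrite big1 // => a _; rewrite big1 // => b _; rewrite gser_low ?mulr0 ?mul0r //.
have /c_le1 : range 1 n k by move: Ii Ij; rewrite /range; lia.
lia.
Qed.

Lemma serF_diag k : serF k k = 1.
Proof. by apply: funext => r; rewrite /serF /fser eqxx ser1. Qed.

Lemma serE_diag k : serE k k = 1.
Proof. by apply: funext => r; rewrite /serE /eser eqxx ser1. Qed.

Lemma serF_upper i k : (i < k)%N -> serF i k = 0.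
Proof. by move=> ik; apply: funext => r; rewrite /serF /fser ltn_eqF // ltnNge ltnW. Qed.

Lemma serE_lower k j : (j < k)%N -> serE k j = 0.
Proof. by move=> jk; apply: funext => r; rewrite /serE /eser gtn_eqF // ltnNge ltnW. Qed.

(** The summation range in [gauss_decomp] and the one in a product of three series differ only by
    vanishing terms. *)
Lemma gauss_series i j r : range 1 n i -> range 1 n j ->
  schur n serF serE serG 1 i j r = t i j (r%:Z - c 1%N).
Proof.
move=> Ii Ij; rewrite t_gauss // /schur ser_sum.
have ijn : (minn i j < n.+1)%N by move: Ii Ij; rewrite /range; lia.
rewrite (@big_cat_nat _ _ _ (minn i j).+1) //=.
rewrite [X in _ + X]big_nat [X in _ + X]big1 ?addr0; last first.
  move=> k /andP[ijk _]; rewrite gtn_min in ijk.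
  case/orP: ijk => [/serF_upper ->|/serE_lower ->]; first by rewrite !mul0r.
  by rewrite mulr0.
rewrite big_nat [RHS]big_nat; apply: eq_bigr => k /andP[k1 kij].
have ck : c k = c 1%N - (shift_of k)%:Z.
  by apply: c_shift; move: Ii Ij; rewrite /range; lia.
set r' := r%:Z - c 1%N.
pose P (a b : nat) := fser f i k a%:Z * gser c g k (r' - a%:Z - b%:Z) * eser e k j b%:Z.
have P0 a b : r%:Z - (shift_of k)%:Z < a%:Z + b%:Z -> P a b = 0.
  by move=> ab; rewrite /P gser_low ?mulr0 ?mul0r //; rewrite /r' ck; lia.
transitivity (\sum_(a < r.+1) \sum_(b < r.+1) P a b).
  rewrite exchange_big serM_rev /=; apply: eq_bigr => b _.
  rewrite serM mulr_suml (@sum_extend _ (r - b).+1 r.+1 (fun a => P a b)); first last.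
  - by move=> a ab; apply: P0; lia.
  - by rewrite ltnS leq_subr.
  apply: eq_bigr => a _; rewrite /P /serF /serG /serE; congr (_ * gser c g k _ * _).
  have := ltn_ord a; have := ltn_ord b; rewrite /r'; lia.
have -> : absz (r' + c k) = absz (r%:Z - (shift_of k)%:Z) by rewrite /r' ck; congr absz; lia.
(* Below the leading exponent the absolute value still gives a nonempty range, but all its terms are
   zero. *)
case: (ltnP r (shift_of k)) => rk.
  by rewrite !big1 // => a _; rewrite big1 // => b _; apply: P0; lia.
have -> : absz (r%:Z - (shift_of k)%:Z) = (r - shift_of k)%N by lia.
rewrite (@sum_extend _ (r - shift_of k).+1 r.+1 (fun a => \sum_(b < r.+1) P a b)).
- apply: eq_bigr => a _.
  by apply: (@sum_extend _ (r - shift_of k).+1 r.+1 (P a)) => [|b ab]; [lia | apply: P0; lia].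
- lia.
- by move=> a ra; rewrite big1 // => b _; apply: P0; lia.
Qed.

Lemma gauss_data_of_rtt : gauss_data n shift_of serF serE serG.
Proof.
apply: GaussData.
- exact: serF_diag.
- exact: serE_diag.
- exact: serF_upper.
- exact: serE_lower.
- by move=> i k ki; rewrite /serF /fser gtn_eqF // andbF.
- by move=> k j kj; rewrite /serE /eser ltn_eqF // andbF.
- exact: serG_leading.
- move=> i j k l s Ii Ij Ik Il; rewrite !gauss_series //.
  (* One step below the lowest exponent all coefficients of $T$ vanish, and a single bracket
     survives in the RTT relation. *)
  have := @t_rtt i j k l (- c 1%N - 1) (s%:Z - c 1%N) Ii Ij Ik Il.
  rewrite subrK add0r /comm /brk !(@t_low _ _ (- c 1%N - 1)) //; try lia.
  by rewrite !(mulr0, mul0r) !subr0.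
- move=> i j k l r s Ii Ij Ik Il; rewrite !gauss_series //.
  have := @t_rtt i j k l (r%:Z - c 1%N) (s%:Z - c 1%N) Ii Ij Ik Il.
  have -> : r%:Z - c 1%N + 1 = r.+1%:Z - c 1%N by lia.
  by have -> : s%:Z - c 1%N + 1 = s.+1%:Z - c 1%N by lia.
- exact: algC_two.
Qed.

Let Dat := gauss_data_of_rtt.

Local Notation m := shift_of.

(** By (Y0), $\widetilde D_i(z)$ is minus the inverse of $D_i(z)$. The inverse is taken after
    splitting off $z^{c_i}$, whence the index [s - c i]. *)
Definition Dtilde (i : nat) (s : int) : A :=
  - ser_inv (ser_shift (m i) (serG i)) (absz (s - c i)).

Let eE i p : e i i.+1 p.+1%:Z = serE i i.+1 p.+1.
Proof. by rewrite /serE /eser ltn_eqF // ltnSn. Qed.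

Let fE i p : f i.+1 i p.+1%:Z = serF i.+1 i p.+1.
Proof. by rewrite /serF /fser gtn_eqF // ltnSn. Qed.

Let eN i (r : int) q : r = q%:Z -> (0 < q)%N -> e i i.+1 r = serE i i.+1 q.
Proof. by move=> -> ; case: q => // q _; apply: eE. Qed.

Let fN i (r : int) q : r = q%:Z -> (0 < q)%N -> f i.+1 i r = serF i.+1 i q.
Proof. by move=> -> ; case: q => // q _; apply: fE. Qed.

Let int_pos (r : int) : 1 <= r -> exists p : nat, r = p.+1%:Z.
Proof. by move=> r1; exists (absz r).-1; lia. Qed.

Let int_ge (d r : int) : d <= r -> exists p : nat, r = d + p%:Z.
Proof. by move=> dr; exists (absz (r - d)); lia. Qed.

Let U i := ser_shift (m i) (serG i).

Let U0 i : range 1 n i -> U i 0%N = 1.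
Proof. by move=> /serG_leading[_ <-]; rewrite /U /ser_shift add0n. Qed.

Lemma zsum_nil (a b : int) (X : int -> A) : b < a -> zsum a b X = 0.
Proof. by move=> ba; rewrite /zsum leNgt ba. Qed.

Lemma Dtilde_inv i (r : nat) : range 1 n i ->
  zsum (- c i) (r%:Z - c i) (fun k => gser c g i k * Dtilde i (r%:Z - k)) = - kdelta A r 0.
Proof.
move=> Ii; have -> : r%:Z - c i = - c i + r.+1%:Z - 1 by lia.
rewrite zsumE; have := congr1 (fun X : series A => X r) (ser_mulfV (U0 Ii)).
rewrite ser1 serM => UV.
transitivity (- \sum_(k < r.+1) U i k * ser_inv (U i) (r - k)%N).
  rewrite -sumrN; apply: eq_bigr => k _; rewrite gserE // /Dtilde mulrN; congr (- (_ * _)).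
  by congr ser_inv; have := ltn_ord k; lia.
by rewrite UV /kdelta; case: (r == 0%N).
Qed.

Lemma EF_diag i p q : (1 <= i < n)%N ->
  brk (serE i i.+1 p.+1) (serF i.+1 i q.+1) =
  - zsum (c i) (p.+1%:Z + q.+1%:Z - 1 + c i.+1)
      (fun k => Dtilde i k * gser c g i.+1 (p.+1%:Z + q.+1%:Z - k - 1)).
Proof.
move=> iin; rewrite (EF_sum Dat) ?shift_le // serM.
have Ii : range 1 n i by case/andP: iin => i1 /ltnW; rewrite /range i1.
have Ii' : range 1 n i.+1 by case/andP: iin.
have ci := c_shift Ii; have ci' := c_shift Ii'; have mi := shift_le iin.
have V0 k : (k <= (p + q).+1 < k + (m i.+1 - m i))%N ->
    ser_inv (U i) k * ser_shift (m i) (serG i.+1) ((p + q).+1 - k)%N = 0.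
  move=> kpq; rewrite /ser_shift /serG gser_low ?mulr0 //; rewrite ci'; lia.
(* When the gap between the weights exceeds [(p + q).+1], the sum in (Y1) is empty and every product
   of series coefficients vanishes. Otherwise [N] is its number of terms. *)
have [pq|pq] := leqP (m i.+1 - m i) (p + q).+1; last first.
  rewrite zsum_nil ?oppr0; last by rewrite ci ci'; lia.
  by rewrite big1 // => k _; apply: V0; have := ltn_ord k; lia.
set N := ((p + q).+2 - (m i.+1 - m i))%N.
have -> : p.+1%:Z + q.+1%:Z - 1 + c i.+1 = c i + N%:Z - 1 by rewrite /N ci ci'; lia.
rewrite zsumE -sumrN.
rewrite (@sum_extend _ N _ (fun k => ser_inv (U i) k
  * ser_shift (m i) (serG i.+1) ((p + q).+1 - k)%N)) ?leq_subr //; last first.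
  by move=> k Nk; apply: V0; move: Nk; rewrite /N; lia.
apply: eq_bigr => k _; rewrite /Dtilde mulNr opprK; congr (_ * _).
  by congr ser_inv; lia.
rewrite /ser_shift /serG; congr gser; have := ltn_ord k; rewrite /N ci; lia.
Qed.

Lemma drinfeld_of_rtt :
  drinfeld_rels n (fun i => - c i) (fun i => e i i.+1) (fun i => f i.+1 i)
    (gser c g) Dtilde.
Proof.
split; first by move=> i _; rewrite /gser eqxx.
split; first by move=> i r /Dtilde_inv.
split.
  move=> i j r s Ii Ij /int_ge[p ->] /int_ge[q ->].
  by rewrite !gserE //; apply: (G_comm Dat).
split.
  move=> i j r s iin jin /int_pos[p ->] /int_pos[q ->].
  rewrite eE fE /kdelta opprK; case: (ltngtP i j) => [ij|ij|<-].
  - by rewrite mul0r oppr0; apply: (EF_comm Dat); lia.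
  - by rewrite mul0r oppr0; apply: (FE_comm Dat); lia.
  - by rewrite mul1r opprK; apply: EF_diag.
split.
  move=> i j r s Ii jn /int_ge[p ->] /int_pos[q ->].
  rewrite zsumE gserE // eE /kdelta.
  (* Because [k < p], the index [p + q - k] is positive; at index 0 [serE] is zero while [e] is
     arbitrary. *)
  have S (k : 'I_p) : gser c g i (- c i + k%:Z)
       * e j j.+1 (- c i + p%:Z + q.+1%:Z - (- c i + k%:Z) - 1)
     = serG i (k + m i)%N * serE j j.+1 (p + q - k)%N.
    by rewrite gserE // (@eN j _ (p + q - k)%N) //; have := ltn_ord k; lia.
  under eq_bigr => k _ do rewrite S.
  case: (eqVneq i j) => [ij|ij].
    subst j; rewrite ltn_eqF // sub0r mulN1r; exact: (GE_sum_eq Dat).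
  case: (eqVneq i j.+1) => [ij'|ij'].
    subst i; rewrite subr0 mul1r; exact: (GE_sum_next Dat).
  by rewrite subrr mul0r; apply: (GE_comm Dat).
split.
  move=> i j r s Ii jn /int_ge[p ->] /int_pos[q ->].
  rewrite zsumE gserE // fE /kdelta.
  have S (k : 'I_p) :
      f j.+1 j (- c i + p%:Z + q.+1%:Z - (- c i + k%:Z) - 1) * gser c g i (- c i + k%:Z)
     = serF j.+1 j (p + q - k)%N * serG i (k + m i)%N.
    by rewrite gserE // (@fN j _ (p + q - k)%N) //; have := ltn_ord k; lia.
  under eq_bigr => k _ do rewrite S.
  case: (eqVneq i j) => [ij|ij].
    subst j; rewrite ltn_eqF // subr0 mul1r; exact: (GF_sum_eq Dat).
  case: (eqVneq i j.+1) => [ij'|ij'].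
    subst i; rewrite sub0r mulN1r; exact: (GF_sum_next Dat).
  by rewrite subrr mul0r; apply: (GF_comm Dat).
have S1 p : p.+1%:Z - 1 = 1 + p%:Z - 1 by lia.
split.
  move=> i r s iin /int_pos[p ->] /int_pos[q ->]; rewrite !eE !S1 !zsumE.
  apply: etrans (EE_sum Dat p q iin) _; congr (_ - _); apply: eq_bigr => k _;
    by rewrite (@eN i _ k.+1) ?(@eN i _ (p + q - k)%N) //; have := ltn_ord k; lia.
split.
  move=> i r s iin /int_pos[p ->] /int_pos[q ->]; rewrite !fE !S1 !zsumE.
  apply: etrans (FF_sum Dat p q iin) _; congr (_ - _); apply: eq_bigr => k _;
    by rewrite (@fN i _ (p + q - k)%N) ?(@fN i _ k.+1) //; have := ltn_ord k; lia.
have S2 p : p.+1%:Z + 1 = p.+2%:Z by lia.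
split.
  by move=> i r s i1 ni /int_pos[p ->] /int_pos[q ->]; rewrite !S2 !eE; apply: (EE_next Dat).
split.
  by move=> i r s i1 ni /int_pos[p ->] /int_pos[q ->]; rewrite !S2 !fE; apply: (FF_next Dat).
split.
  move=> i j r s iin jn ij /int_pos[p ->] /int_pos[q ->]; rewrite !eE !fE.
  have [ij'|ij'] := ltnP i j.
    by split; [apply: (E_far Dat) | apply: (F_far Dat)]; lia.
  rewrite /comm -!/(brk _ _) brkN (brkN (serF _ _ _)).
  by rewrite (E_far Dat) ?(F_far Dat) ?oppr0 //; lia.
move=> i j r s k iin jn ij /int_pos[p ->] /int_pos[q ->] /int_pos[o ->]; rewrite !eE !fE.
have [ij'|ij'] : j = i.+1 \/ i = j.+1 by lia.
  by subst j; split; [apply: (serre_a Dat) | apply: (serre_f_left Dat)]; lia.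
by subst i; split; [apply: (serre_c Dat) | apply: (serre_f_right Dat)]; lia.
Qed.

End Translation.

(** * Surjectivity and uniqueness *)

Section Image.
Variables (A B : algType CC) (phi : {lrmorphism A -> B}).

Definition image_pred : B -> bool := fun y => `[< exists x, phi x = y >].

Lemma image_predP y : reflect (exists x, phi x = y) (y \in image_pred).
Proof. exact: asboolP. Qed.

Fact image_subalg_closed : subalg_closed image_pred.
Proof.
split.
- by apply/image_predP; exists 1; rewrite rmorph1.
- move=> a _ _ /image_predP[x <-] /image_predP[y <-].
  by apply/image_predP; exists (a *: x + y); rewrite linearP.
- move=> _ _ /image_predP[x <-] /image_predP[y <-].
  by apply/image_predP; exists (x * y); rewrite rmorphM.
Qed.

HB.instance Definition _ := GRing.isSubalgClosed.Build CC B image_pred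
  (GRing.subalg_closed_semi image_subalg_closed).

(** The image as an algebra in its own right, so that it can serve as a target in the universal
    property. *)
Record image_alg := ImageAlg { image_val : B; image_valP : image_val \in image_pred }.

HB.instance Definition _ := [isSub for image_val].
HB.instance Definition _ := [Choice of image_alg by <:].
HB.instance Definition _ := [SubChoice_isSubAlgebra of image_alg by <:].

Definition image_inj (y : image_alg) : B := \val y.

HB.instance Definition _ := GRing.isZmodMorphism.Build image_alg B image_inj
  (raddfB (\val : {additive image_alg -> B})).
HB.instance Definition _ := GRing.isMonoidMorphism.Build image_alg B image_inj
  (rmorphism_monoidP (\val : {rmorphism image_alg -> B})).
HB.instance Definition _ := GRing.isScalable.Build CC image_alg B *:%R image_inj
  (linearZZ (\val : {linear image_alg -> B})).
End Image.

Lemma zsum_morph (A B : algType CC) (psi : {lrmorphism A -> B}) a b (X : int -> A) :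
  psi (zsum a b X) = zsum a b (fun k => psi (X k)).
Proof. by rewrite /zsum; case: ifP; rewrite ?rmorph0 // rmorph_sum. Qed.

(** Since the leading coefficient of [D] is 1, the product determines [X] recursively. This fixes
    the images of $\widetilde D_i$ once those of $D_i$ are known. *)
Lemma left_inverse_unique (A : algType CC) (d : int) (D X X' : int -> A) : D d = 1 ->
  (forall r : nat, zsum d (r%:Z + d) (fun k => D k * X (r%:Z - k)) =
                   zsum d (r%:Z + d) (fun k => D k * X' (r%:Z - k))) ->
  forall s, - d <= s -> X s = X' s.
Proof.
move=> Dd XX' s ds; have -> : s = (absz (s + d))%:Z - d by lia.
move: (absz _) => r {s ds}; elim/ltn_ind: r => r IH.
have := XX' r; have -> : r%:Z + d = d + r.+1%:Z - 1 by lia.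
rewrite !zsumE !big_ord_recl /= addr0 Dd !mul1r => E.
apply: (addIr _ (etrans E _)); congr (_ + _); apply: eq_bigr => k _; congr (_ * _).
have -> : r%:Z - (d + (lift ord0 k)%:Z) = (r - k.+1)%N%:Z - d.
  by have := ltn_ord k; rewrite /= /bump; lia.
by rewrite IH //; have := ltn_ord k; lia.
Qed.

Lemma rtt_generated n c (Y Yr : algType CC) (t : nat -> nat -> int -> Yr) e f g
    (phi : {lrmorphism Y -> Yr}) :
  is_rtt_shifted_yangian n c t -> gauss_decomp n c t e f g ->
  (forall i j r, (1 <= i)%N -> (i < j <= n)%N -> 1 <= r -> e i j r \in image_pred phi) ->
  (forall i j r, (1 <= j)%N -> (j < i <= n)%N -> 1 <= r -> f i j r \in image_pred phi) ->
  (forall k r, (1 <= k <= n)%N -> - c k < r -> g k r \in image_pred phi) ->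
  forall x, exists y, phi y = x.
Proof.
move=> [[t_rtt _] t_univ] t_gauss eI fI gI.
pose B : algType CC := image_alg phi.
(* Elements outside the image are sent to 0; [fser], [gser] and [eser] read no such values in the
   sums below. *)
pose lift (y : Yr) : B := insubd (0 : B) y.
have liftK y : y \in image_pred phi -> val (lift y) = y by move=> yI; rewrite insubdK.
pose e' i j r := lift (e i j r); pose f' i j r := lift (f i j r); pose g' k r := lift (g k r).
pose t' i j (r : int) := \sum_(1 <= k < (minn i j).+1)
  \sum_(a < (absz (r + c k)).+1) \sum_(b < (absz (r + c k)).+1)
    fser f' i k a%:Z * gser c g' k (r - a%:Z - b%:Z) * eser e' k j b%:Z.
have val_t i j r : (1 <= i <= n)%N -> (1 <= j <= n)%N -> image_inj (t' i j r) = t i j r.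
  move=> Ii Ij; rewrite t_gauss // rmorph_sum /= big_nat [RHS]big_nat.
  apply: eq_bigr => k /andP[k1 kij].
  rewrite rmorph_sum; apply: eq_bigr => a _; rewrite rmorph_sum; apply: eq_bigr => b _.
  rewrite !rmorphM; congr (_ * _ * _).
  - rewrite /fser; case: eqVneq => ik; first by case: ifP; rewrite ?rmorph1 ?rmorph0.
    case: ifP => [/andP[ki a1]|_]; last by rewrite rmorph0.
    by apply: liftK; apply: fI => //; lia.
  - rewrite /gser; case: ifP => _; first by rewrite rmorph1.
    case: ifP => [kr|_]; last by rewrite rmorph0.
    by apply: liftK; apply: gI => //; lia.
  - rewrite /eser; case: eqVneq => ik; first by case: ifP; rewrite ?rmorph1 ?rmorph0.
    case: ifP => [/andP[ki a1]|_]; last by rewrite rmorph0.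
    by apply: liftK; apply: eI => //; lia.
have inj : injective (@image_inj _ _ phi) by exact: val_inj.
have t'_rels : rtt_rels n c t'.
  split; last by exists e', f', g'.
  move=> i j k l r s Ii Ij Ik Il; apply: inj.
  by rewrite /comm !(rmorphB, rmorphM) /= !val_t //; apply: t_rtt.
have [chi [chi_t _]] := t_univ _ _ t'_rels.
have t_rels : rtt_rels n c t by split=> //; exists e, f, g.
have [id' [_ id_uniq]] := t_univ _ _ t_rels.
move=> x; apply/image_predP.
(* The inclusion after [chi] and the identity agree on the generators [t], so the uniqueness clause
   identifies them. *)
have -> : x = image_inj (chi x).
  pose psi : {lrmorphism Yr -> Yr} := GRing.LRMorphism.clone _ _ _ _ (@image_inj _ _ phi \o chi) _.
  pose one : {lrmorphism Yr -> Yr} := GRing.LRMorphism.clone _ _ _ _ (@idfun Yr) _.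
  rewrite -[RHS]/(psi x) -[LHS]/(one x) (id_uniq one) // (id_uniq psi) // => i j r Ii Ij.
  by rewrite /psi /= chi_t // val_t.
exact: image_valP.
Qed.

(** * Generation of the off-diagonal Gauss factors *)

Section Generation.
Variables (n : nat) (m : nat -> nat) (A B : algType CC) (phi : {lrmorphism A -> B})
  (F E : nat -> nat -> series B) (G : nat -> series B).
Hypothesis H : gauss_data n m F E G.

Lemma brk_image x y :
  x \in image_pred phi -> y \in image_pred phi -> brk x y \in image_pred phi.
Proof. by move=> Ix Iy; rewrite /brk rpredB ?rpredM. Qed.

Lemma E_image :
  (forall i r, (1 <= i < n)%N -> (0 < r)%N -> E i i.+1 r \in image_pred phi) ->
  forall i j r, (1 <= i)%N -> (i < j <= n)%N -> (0 < r)%N -> E i j r \in image_pred phi.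
Proof.
move=> EI i j; move: {2}(j - i)%N (leqnn (j - i)) => d.
elim: d i => [|d IH] i dij r i1 ijn r0; first by lia.
case: (eqVneq j i.+1) => [->|ij]; first by apply: EI => //; lia.
rewrite (E_generate H) //; last by lia.
by apply: brk_image; [apply: IH | apply: EI]; lia.
Qed.

Lemma F_image :
  (forall i r, (1 <= i < n)%N -> (0 < r)%N -> F i.+1 i r \in image_pred phi) ->
  forall i j r, (1 <= j)%N -> (j < i <= n)%N -> (0 < r)%N -> F i j r \in image_pred phi.
Proof.
move=> FI i j; move: {2}(i - j)%N (leqnn (i - j)) => d.
elim: d j => [|d IH] j dij r j1 jin r0; first by lia.
case: (eqVneq i j.+1) => [->|ij]; first by apply: FI => //; lia.
rewrite (F_generate H) //; last by lia.
by apply: brk_image; [apply: FI | apply: IH]; lia.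
Qed.

End Generation.

Theorem theorem2p18 (n : nat) (hn : (2 <= n)%N) (c : nat -> int)
  (hmu : dominant n c)
  (Y : algType CC) (E F D Dt : nat -> int -> Y)
  (hY : is_drinfeld_shifted_yangian n (fun i => - c i) E F D Dt)
  (Yr : algType CC) (t : nat -> nat -> int -> Yr)
  (hYr : is_rtt_shifted_yangian n c t)
  (e f : nat -> nat -> int -> Yr) (g : nat -> int -> Yr)
  (hgauss : gauss_decomp n c t e f g) :
  exists Ups : {lrmorphism Y -> Yr},
    [/\ (forall x : Yr, exists y : Y, Ups y = x),
        (forall i r, (1 <= i < n)%N -> 1 <= r ->
            Ups (E i r) = e i i.+1 r /\ Ups (F i r) = f i.+1 i r),
        (forall j s, (1 <= j <= n)%N -> - c j <= s ->
            Ups (D j s) = gser c g j s)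
      & (forall Psi : {lrmorphism Y -> Yr},
          (forall i r, (1 <= i < n)%N -> 1 <= r ->
              Psi (E i r) = e i i.+1 r /\ Psi (F i r) = f i.+1 i r) ->
          (forall j s, (1 <= j <= n)%N -> - c j <= s ->
              Psi (D j s) = gser c g j s) ->
          forall y, Psi y = Ups y)].
Proof.
have n0 : (0 < n)%N by apply: ltnW.
have [[t_rtt _] _] := hYr; have [[_ [hYinv _]] hYuniv] := hY.
have Dat := gauss_data_of_rtt n0 hmu t_rtt hgauss.
have [Ups [UEF [UD [UDt Uuniq]]]] := hYuniv _ _ _ _ _ (drinfeld_of_rtt n0 hmu t_rtt hgauss).
have nat1 (r : int) : 1 <= r -> r = (absz r)%:Z /\ (0 < absz r)%N by lia.
exists Ups; split=> //.
- apply: (rtt_generated hYr hgauss).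
  + move=> i j r i1 ijn /nat1[rE r0].
    have -> : e i j r = serE e i j (absz r).
      by rewrite /serE /eser -rE ltn_eqF ?ifT //; lia.
    apply: (E_image (phi := Ups) Dat) => // k s kn s0.
    apply/image_predP; exists (E k s%:Z); rewrite (proj1 (UEF _ _ _ _)) //.
    by rewrite /serE /eser ltn_eqF ?ifT //; lia.
  + move=> i j r i1 ijn /nat1[rE r0].
    have -> : f i j r = serF f i j (absz r).
      by rewrite /serF /fser -rE gtn_eqF ?ifT //; lia.
    apply: (F_image (phi := Ups) Dat) => // k s kn s0.
    apply/image_predP; exists (F k s%:Z); rewrite (proj2 (UEF _ _ _ _)) //.
    by rewrite /serF /fser gtn_eqF ?ifT //; lia.
  + move=> k r kn rk; apply/image_predP; exists (D k r).
    by rewrite UD ?ltW // /gser gt_eqF // rk.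
(* Uniqueness in the presentation also asks for the values on [Dt]. Applying [Psi] to (Y0)
   determines them from the values on [D]. *)
- move=> Psi PEF PD; apply: Uuniq => // i s Ii.
  apply: (@left_inverse_unique _ (- c i) (gser c g i) (fun s => Psi (Dt i s))) => //.
    by rewrite /gser eqxx.
  move=> r; transitivity (- kdelta Yr r 0); last by apply/esym; apply: (Dtilde_inv (n := n)).
  have := congr1 Psi (hYinv i r Ii); rewrite zsum_morph rmorphN /kdelta rmorph_nat => <-.
  have -> : r%:Z - c i = - c i + r.+1%:Z - 1 by lia.
  rewrite !zsumE; apply: eq_bigr => k _; rewrite /= rmorphM; congr (_ * _).
  by apply/esym; apply: PD => //; lia.
Qed.
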